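(* Let $A=\bigoplus_\lambda^{c_0}K(H_\lambda)$ be a compact C$^*$-algebra and let $c\in A$ satisfy the rank hypothesis (RH): $\operatorname{rank}(\pi_\lambda(c))\le \dim(H_\lambda)-2$ for all $\lambda$. Then $A$ is determined by products at $c$ as a Banach algebra: for every Banach space $X$ and every bounded bilinear map $V:A\times A\to X$ having the product property at $c$, there exists a bounded linear map $\varphi:A\to X$ with $V(a,b)=\varphi(ab)$ for all $a,b\in A$. In particular, if no $H_\lambda$ is finite-dimensional, then $A$ is determined (as a Banach algebra) by products at every element $c\in A$.
   Context: All algebras and vector spaces are complex. For a family of Hilbert spaces $H_\lambda$, $\bigoplus_\lambda^{c_0}K(H_\lambda)$ is the C$^*$-algebra of families $(x_\lambda)$ with $x_\lambda\in K(H_\lambda)$ (compact operators) and $\|x_\lambda\|\to 0$, with the sup norm; $\pi_\lambda$ denotes the coordinate projection onto $K(H_\lambda)$. The rank of an operator is the dimension of its range (possibly infinite); if $\dim H_\lambda=\infty$ the condition $\operatorname{rank}\le\dim H_\lambda-2$ is automatic. For a Banach algebra $A$, a Banach space $X$ and $c\in A$, a bounded bilinear map $V:A\times A\to X$ has the product property at $c$ if there is a linear map $\varphi:A\to X$ such that $V(a,b)=\varphi(ab)$ for all $a,b\in A$ with $ab=c$. *)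

(* Defs.v *)
From mathcomp Require Import all_boot all_order all_algebra.
From mathcomp Require Import all_classical all_reals topology normedtype.
From mathcomp Require Export complex.
Import Order.TTheory GRing.Theory Num.Theory.
Set Implicit Arguments.
Unset Strict Implicit.
Unset Printing Implicit Defensive.
Local Open Scope ring_scope.
Local Open Scope classical_set_scope.

Section Defs.
Context {R : realType}.
Local Notation C := R[i].

(** Inner product on a complex normed space inducing its norm:
    linear in the first variable, conjugate symmetric, <x,x> = |x|^2.
    A Hilbert space is a complete normed space with such an inner product. *)
Definition is_inner_product (H : normedModType C) (ip : H -> H -> C) : Prop :=
  [/\ forall (a : C) (x y z : H), ip (a *: x + y) z = a * ip x z + ip y z,
      forall x y : H, ip y x = (ip x y)^*
    & forall x : H, ip x x = `|x| ^+ 2].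

Definition linear_op (H : normedModType C) (f : H -> H) : Prop :=
  forall (a : C) (x y : H), f (a *: x + y) = a *: f x + f y.

Definition compact_op (H : normedModType C) (f : H -> H) : Prop :=
  linear_op f /\ compact (closure (f @` [set x : H | `|x| <= 1])).

Definition op_le (H : normedModType C) (f : H -> H) (s : R) : Prop :=
  forall x : H, `|f x| <= (s%:C)%C * `|x|.

Definition rank_le (H : normedModType C) (f : H -> H) (k : nat) : Prop :=
  exists w : 'I_k -> H, forall x : H,
    exists coef : 'I_k -> C, f x = \sum_(i < k) coef i *: w i.

Definition has_dim (H : normedModType C) (n : nat) : Prop :=
  exists e : 'I_n -> H,
    (forall coef : 'I_n -> C, \sum_(i < n) coef i *: e i = 0 -> forall i, coef i = 0)
    /\ (forall x : H, exists coef : 'I_n -> C, x = \sum_(i < n) coef i *: e i).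

Definition finite_dim (H : normedModType C) : Prop := exists n, has_dim H n.

Section Family.
Variables (L : Type) (H : L -> completeNormedModType C).

Definition Elt := forall l : L, H l -> H l.

(** Membership in A = c0-direct sum of the K(H_l): each x_l compact and
    ||x_l|| -> 0 (for every e > 0 only finitely many l have ||x_l|| > e). *)
Definition inA (x : Elt) : Prop :=
  (forall l, compact_op (x l)) /\
  (forall e : R, 0 < e -> finite_set [set l | ~ op_le (x l) e]).

Definition addA (x y : Elt) : Elt := fun l v => x l v + y l v.
Definition scaleA (a : C) (x : Elt) : Elt := fun l v => a *: x l v.
Definition mulA (x y : Elt) : Elt := fun l => x l \o y l.

Definition normA_le (x : Elt) (s : R) : Prop := forall l, op_le (x l) s.

Definition pi_rank_hyp (c : Elt) : Prop :=
  forall l, ~ finite_dim (H l) \/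
    exists n, [/\ has_dim (H l) n, (2 <= n)%N & rank_le (c l) (n - 2)].

Section Maps.
Variable X : completeNormedModType C.

Definition linear_on_A (phi : Elt -> X) : Prop :=
  forall (k : C) (a b : Elt), inA a -> inA b ->
    phi (addA (scaleA k a) b) = k *: phi a + phi b.

Definition bounded_on_A (phi : Elt -> X) : Prop :=
  exists M : R, forall (a : Elt) (s : R), inA a -> 0 <= s -> normA_le a s ->
    `|phi a| <= ((M * s)%:C)%C.

Definition bounded_bilinear_on_A (V : Elt -> Elt -> X) : Prop :=
  [/\ forall (k : C) (a1 a2 b : Elt), inA a1 -> inA a2 -> inA b ->
        V (addA (scaleA k a1) a2) b = k *: V a1 b + V a2 b,
      forall (k : C) (a b1 b2 : Elt), inA a -> inA b1 -> inA b2 ->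
        V a (addA (scaleA k b1) b2) = k *: V a b1 + V a b2
    & exists M : R, forall (a b : Elt) (s t : R), inA a -> inA b ->
        0 <= s -> 0 <= t -> normA_le a s -> normA_le b t ->
        `|V a b| <= ((M * s * t)%:C)%C].

Definition product_property_at (V : Elt -> Elt -> X) (c : Elt) : Prop :=
  exists phi : Elt -> X, linear_on_A phi /\
    forall a b : Elt, inA a -> inA b -> mulA a b = c -> V a b = phi (mulA a b).
End Maps.

Definition determined_at (c : Elt) : Prop :=
  forall (X : completeNormedModType C) (V : Elt -> Elt -> X),
    bounded_bilinear_on_A V -> product_property_at V c ->
    exists phi : Elt -> X, [/\ linear_on_A phi, bounded_on_A phi &
      forall a b : Elt, inA a -> inA b -> V a b = phi (mulA a b)].

End Family.
End Defs.

(* Main.v *)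
(** A bounded bilinear map V with the product property at c is constant on the
pairs (a, b) with ab = c.  For rank one elements y = p (x) g and z = q (x) h
with yz = 0, the rank hypothesis leaves enough room to factor c = ab with
aq = 0 and with the range of b inside ker g, so that az = 0 and yb = 0.  Then
(a + y)(b + z) = a (b + z) = (a + y) b = ab = c, and bilinearity gives
V(y, z) = 0.  Hence V(yx, w) = V(y, xw), first for rank one elements, then
everywhere by density; a left approximate unit and the fact that every element
of A is a product turn this into V(a, b) = phi(ab).

The factorization c = ab of a compact operator avoids spectral theory.  Vectors
f_k almost attaining the norm t_k of the k-th residual (1 - P_k) c are chosen
greedily; compactness forces t_k -> 0.  Given orthonormal g_k, put
a = sum_k t_k^(1/2) <., g_k> f_k and b = sum_k t_k^(-1/2) <c ., f_k> g_k; both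
series converge in operator norm, and the g_k may be placed freely. *)

Require Import Defs.
From mathcomp Require Import all_boot all_order all_algebra.
From mathcomp Require Import all_classical all_reals topology normedtype.
From mathcomp Require Import complex ring lra.
Import Order.TTheory GRing.Theory Num.Theory.
Import numFieldNormedType.Exports.
Set Implicit Arguments.
Unset Strict Implicit.
Unset Printing Implicit Defensive.
Local Open Scope ring_scope.
Local Open Scope classical_set_scope.
Local Open Scope complex_scope.
(* mathcomp has other constants named addA and mulA. *)
Import Defs.
Arguments addA {R L H} x y l v.
Arguments scaleA {R L H} a x l v.
Arguments mulA {R L H} x y l _.

(** The 2 in the rank hypothesis counts two linear conditions. The vector [g_k] must be orthogonal
    to its [k] predecessors and to the vector q killed by [a], and must lie in the kernel of the
    functional g that is to contain the range of [b]. These are [k + 2] conditions, solvable among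
    [k + 3] independent vectors. A nonzero [f_k] forces rank at least [k + 1], hence dimension at
    least [k + 3]; once [f_k = 0] the series has ended and [g_k = 0] will do. The even split of
    [t_k] into square roots bounds both factors by a multiple of the square root of the norm of
    [c_l]. Factors chosen coordinate by coordinate therefore still have norms tending to 0, that is,
    they belong to the c0-sum. The passage from V(y, z) = 0 to associativity on rank one elements
    rests on V(p (x) g, q (x) h) = g(q) W(p, h): a bilinear form in (g, q) that vanishes whenever
    g(q) = 0 is a multiple of g(q). *)

Section RealNorm.
Context {R : realType}.
Local Notation C := R[i].

(* Norms over R[i] are R[i]-valued; nr is the underlying real number. *)
Definition nr (E : normedZmodType C) (x : E) : R := complex.Re `|x|.

Lemma nrE (E : normedZmodType C) (x : E) : `|x| = (nr x)%:C.
Proof. by rewrite /nr RRe_real // realE normr_ge0. Qed.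

Lemma nr_ge0 (E : normedZmodType C) (x : E) : 0 <= nr x.
Proof. by rewrite -lecR -nrE normr_ge0. Qed.

Lemma nr0 (E : normedZmodType C) : nr (0 : E) = 0.
Proof. by apply/eqP; rewrite -[_ == _](inj_eq (@complexI R)) -nrE normr0. Qed.

Lemma nr_eq0 (E : normedZmodType C) (x : E) : (nr x == 0) = (x == 0).
Proof. by rewrite -[LHS](inj_eq (@complexI R)) -nrE normr_eq0. Qed.

Lemma nrD (E : normedZmodType C) (x y : E) : nr (x + y) <= nr x + nr y.
Proof. by rewrite -lecR rmorphD /= -!nrE ler_normD. Qed.

Lemma nrN (E : normedZmodType C) (x : E) : nr (- x) = nr x.
Proof. by rewrite /nr normrN. Qed.

Lemma nrB (E : normedZmodType C) (x y : E) : nr (x - y) <= nr x + nr y.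
Proof. by rewrite -(nrN y) nrD. Qed.

Lemma nr_distC (E : normedZmodType C) (x y : E) : nr (x - y) = nr (y - x).
Proof. by rewrite -nrN opprB. Qed.

Lemma nr_distD (E : normedZmodType C) (z x y : E) :
  nr (x - y) <= nr (x - z) + nr (z - y).
Proof. by rewrite -(subrKA z) nrD. Qed.

Lemma nrZ (E : normedModType C) (a : C) (x : E) : nr (a *: x) = nr a * nr x.
Proof. by apply: (@complexI R); rewrite rmorphM /= -!nrE normrZ. Qed.

Lemma nrM (a b : C) : nr (a * b) = nr a * nr b.
Proof. by apply: (@complexI R); rewrite rmorphM /= -!nrE normrM. Qed.

Lemma nr_real (a : R) : 0 <= a -> nr a%:C = a.
Proof. by move=> a0; rewrite /nr ger0_norm // lecR. Qed.

Lemma op_leP (H : normedModType C) (f : H -> H) (s : R) :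
  op_le f s <-> forall x, nr (f x) <= s * nr x.
Proof.
by split=> h x; have := h x; rewrite !nrE -rmorphM lecR.
Qed.

End RealNorm.

(** * Compact operators as totally bounded linear operators *)

Section TotallyBounded.
Context {R : realType}.
Local Notation C := R[i].
Variable H : completeNormedModType C.
Implicit Types f g : H -> H.

(** Total boundedness of the image of the unit ball, with net points allowed outside the image.
    Unlike covers of a closure, it passes directly through sums, scalings and uniform limits. *)
Definition tb f := forall e : R, 0 < e -> exists s : seq H,
  forall x, nr x <= 1 -> exists2 y, y \in s & nr (f x - y) <= e.

Lemma nr_ball (x y : H) (e : R) : ball x e%:C y = (nr (x - y) < e) :> Prop.
Proof. by rewrite -ball_normE /= nrE ltcR. Qed.

Lemma ltC_real (e : C) : 0 < e -> exists2 r : R, 0 < r & e = r%:C.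
Proof.
move=> e0; exists (complex.Re e); last by rewrite RRe_real // gtr0_real.
by rewrite -ltcR RRe_real // gtr0_real.
Qed.

Lemma compact_op_tb f : compact_op f -> tb f.
Proof.
move=> [_]; rewrite compact_cover => cf e e0.
have eC : 0 < e%:C by rewrite ltcR.
have [||D _ cD] := cf H setT (fun y => ball y e%:C).
- by move=> y _; apply: ball_open.
- by move=> y _; exists y => //; exact: ballxx.
exists (finmap.enum_fset D) => x x1.
have [|y /= yD] := cD (f x).
  by apply: subset_closure; exists x => //=; rewrite nrE -[1]/(1%:C) lecR.
by rewrite nr_ball nr_distC => /ltW; exists y.
Qed.

(** An ultrafilter containing a finite union of balls contains one of them. Hence an ultrafilter on
    the closure is Cauchy, and completeness provides its limit. *)
Lemma tb_compact_op f : linear_op f -> tb f -> compact_op f.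
Proof.
move=> lf tf; split=> //; rewrite compact_ultra => F UF FK.
have PF : ProperFilter F by exact: ultra_proper.
have : cvg F.
  apply: cauchy_cvg; apply/cauchyP => e /ltC_real[r r0 ->].
  have [|s hs] := tf (r / 4) _; first by lra.
  have : F (\bigcup_(y in [set` s]) ball y r%:C).
    apply: filterS FK => z zc.
    have [|w /= [[x x1 <-]]] := zc (ball z (r / 4)%:C).
      by apply: nbhsx_ballx; rewrite ltcR; lra.
    rewrite nr_ball => zx.
    have [|y ys fy] := hs x; first by rewrite -lecR -nrE.
    exists y => //=; rewrite nr_ball.
    by have := nr_distD (f x) y z; rewrite (nr_distC y (f x)) (nr_distC (f x) z); lra.
  rewrite bigcup_seq; elim: s {hs} => [|y s IH].
    by rewrite big_nil => /filter_ex[].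
  rewrite big_cons => FU.
  have [Fy|Fy] := in_ultra_setVsetC (ball y r%:C) UF; first by exists y.
  apply: IH; apply: filterS (filterI FU Fy) => z [[]//].
move=> cF; exists (lim F); split; last exact: cF.
apply: (@closed_cvg _ _ F _ id (closure (f @` [set x : H | `|x| <= 1]))) => //.
exact: closed_closure.
Qed.

Lemma compact_opP f : compact_op f <-> linear_op f /\ tb f.
Proof.
split=> [cf|[]]; last exact: tb_compact_op.
by split; [case: cf|exact: compact_op_tb].
Qed.

Lemma linear_op0 f : linear_op f -> f 0 = 0.
Proof. by move=> lf; have := lf (-1) 0 0; rewrite scaler0 addr0 scaleN1r addNr. Qed.

Lemma linear_opZ f a x : linear_op f -> f (a *: x) = a *: f x.
Proof. by move=> lf; have := lf a x 0; rewrite (linear_op0 lf) !addr0. Qed.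

Lemma linear_opD f x y : linear_op f -> f (x + y) = f x + f y.
Proof. by move=> lf; have := lf 1 x y; rewrite !scale1r. Qed.

Lemma linear_opB f x y : linear_op f -> f (x - y) = f x - f y.
Proof. by move=> lf; rewrite linear_opD // -scaleN1r linear_opZ // scaleN1r. Qed.

Lemma linear_bound f s : linear_op f -> 0 <= s ->
  (forall x, nr x <= 1 -> nr (f x) <= s) -> op_le f s.
Proof.
move=> lf s0 hs; apply/op_leP => x.
have [->|x0] := eqVneq x 0; first by rewrite linear_op0 // nr0 mulr0.
have nx : 0 < nr x by rewrite lt_neqAle nr_ge0 eq_sym nr_eq0 x0.
have := hs ((nr x)^-1%:C *: x); rewrite linear_opZ // !nrZ nr_real ?invr_ge0 ?nr_ge0 //.
by rewrite mulVf ?gt_eqF // => /(_ (lexx _)); rewrite mulrC ler_pdivrMr // mulrC.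
Qed.

Lemma compact_op_bounded f : compact_op f -> exists2 s, 0 <= s & op_le f s.
Proof.
move=> /compact_opP[lf tf]; have [s hs] := tf 1 ltr01.
have [B hB] : exists B, forall y, y \in s -> nr y <= B.
  elim: s {hs} => [|y s [B hB]]; first by exists 0.
  exists (Num.max (nr y) B) => z; rewrite inE le_max.
  by case/predU1P => [->|/hB ->]; rewrite ?lexx ?orbT.
exists (`|B| + 1); first by rewrite addr_ge0.
apply: linear_bound => //; first by rewrite addr_ge0.
move=> x /hs[y /hB yB fy]; have := nrD (f x - y) y; rewrite subrK.
have := ler_norm B; lra.
Qed.

Lemma tbD f g : tb f -> tb g -> tb (fun x => f x + g x).
Proof.
move=> tf tg e e0; have e2 : 0 < e / 2 by lra.
have [s hs] := tf _ e2; have [t ht] := tg _ e2.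
exists [seq y + z | y <- s, z <- t] => x x1.
have [y ys fy] := hs x x1; have [z zt gz] := ht x x1.
exists (y + z); first exact: allpairs_f.
have -> : f x + g x - (y + z) = (f x - y) + (g x - z) by rewrite addrACA opprD.
by have := nrD (f x - y) (g x - z); lra.
Qed.

Lemma tbZ f a : tb f -> tb (fun x => a *: f x).
Proof.
move=> tf e e0; have na : 0 < nr a + 1 by have := nr_ge0 a; lra.
have [|s hs] := tf (e / (nr a + 1)); first by rewrite divr_gt0.
exists [seq a *: y | y <- s] => x /hs[y ys fy].
exists (a *: y); first exact: map_f.
rewrite -scalerBr nrZ; apply: le_trans (_ : (nr a + 1) * nr (f x - y) <= _).
  by rewrite ler_wpM2r ?nr_ge0 // lerDl.
by rewrite mulrC -ler_pdivlMr.
Qed.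

Lemma compact_opD f g : compact_op f -> compact_op g ->
  compact_op (fun x => f x + g x).
Proof.
move=> /compact_opP[lf tf] /compact_opP[lg tg]; apply/compact_opP; split.
  by move=> a x y; rewrite lf lg scalerDr addrACA.
exact: tbD.
Qed.

Lemma compact_opZ f a : compact_op f -> compact_op (fun x => a *: f x).
Proof.
move=> /compact_opP[lf tf]; apply/compact_opP; split; last exact: tbZ.
by move=> b x y; rewrite lf scalerDr !scalerA mulrC.
Qed.

Lemma compact_op_comp f g s : compact_op f -> linear_op g -> op_le g s ->
  compact_op (f \o g).
Proof.
move=> /compact_opP[lf tf] lg /op_leP gs; apply/compact_opP; split.
  by move=> b x y /=; rewrite lg lf.
(* [g] maps the unit ball into the ball of radius [k], so a net for [k *: f] serves [f \o g]; the
   added 1 makes [k] invertible. *)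
pose k := `|s| + 1; have k0 : 0 < k by rewrite ltr_pwDr.
have tkf := tbZ (k%:C) tf.
move=> e /tkf[t ht]; exists t => x x1; have := ht (k^-1%:C *: g x).
rewrite linear_opZ // scalerA -rmorphM /= mulfV ?gt_eqF // scale1r; apply.
rewrite nrZ nr_real ?invr_ge0 ?(ltW k0) // mulrC ler_pdivrMr // mul1r.
apply: le_trans (gs x) _; apply: le_trans (ler_norm _) _.
rewrite normrM [`|nr x|]ger0_norm ?nr_ge0 //.
by apply: le_trans (_ : `|s| * 1 <= _); rewrite ?ler_wpM2l // mulr1 lerDl.
Qed.

Lemma compact_op_approx f : linear_op f ->
  (forall e : R, 0 < e -> exists2 g, compact_op g & op_le (fun x => f x - g x) e) ->
  compact_op f.
Proof.
move=> lf hf; apply/compact_opP; split=> // e e0.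
have e2 : 0 < e / 2 by lra.
have [g /compact_opP[_ /(_ _ e2)[s hs]] /op_leP hg] := hf _ e2.
exists s => x x1; have [y ys gy] := hs x x1; exists y => //.
have := nr_distD (g x) (f x) y.
have : e / 2 * nr x <= e / 2 * 1 by rewrite ler_wpM2l // ltW.
by have := hg x; lra.
Qed.

Definition bfun (phi : H -> C) := (forall a x y, phi (a *: x + y) = a * phi x + phi y)
  /\ exists2 s : R, 0 <= s & forall x, nr (phi x) <= s * nr x.

(** A square grid of mesh [e / 2]: each coordinate contributes an error of at most [e / 2]. *)
Lemma disc_net (s e : R) : 0 < e -> exists t : seq C,
  forall z : C, nr z <= s -> exists2 w, w \in t & nr (z - w) <= e.
Proof.
move=> e0; pose d := e / 2; have d0 : 0 < d by rewrite /d; lra.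
pose N := (Num.truncn (`|s| / d)).+1.
(* The shift by [N] lets natural numbers enumerate the integers from [-N] to [N]; [N * d] exceeds
   [s]. *)
pose pts := [seq (n%:R - N%:R) * d | n <- iota 0 (N + N).+1].
have real_net (x : R) : `|x| <= s -> exists2 w, w \in pts & `|x - w| <= d.
  move=> xs; pose m := Num.truncn (x / d + N%:R).
  have sN : `|x / d| < N%:R.
    rewrite normrM (gtr0_norm (_ : 0 < d^-1)) ?invr_gt0 //.
    apply: le_lt_trans (_ : `|s| / d < _); last exact: truncnS_gt.
    by rewrite ler_pM2r ?invr_gt0 // (le_trans xs) ?ler_norm.
  have xN : 0 <= x / d + N%:R by move: sN; rewrite ltr_norml; lra.
  have /andP[m1 m2] := truncn_itv xN.
  exists ((m%:R - N%:R) * d).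
    apply/mapP; exists m => //; rewrite mem_iota add0n leq0n /= ltnS -(ler_nat R).
    rewrite (le_trans m1) // natrD; move: sN; rewrite ltr_norml; lra.
  have -> : x - (m%:R - N%:R) * d = (x / d + N%:R - m%:R) * d.
    by rewrite !mulrBl mulrDl divfK ?gt_eqF // opprB addrA.
  rewrite normrM (gtr0_norm d0) -[leRHS]mul1r ler_pM2r //.
  by rewrite ler_norml -/m; move: m1 m2; rewrite -/m -natr1; lra.
exists [seq Complex x y | x <- pts, y <- pts] => z zs.
have ni : `|'i : C| = 1 by rewrite normc_def /= expr0n /= add0r expr1n sqrtr1.
have zr : `|complex.Re z| <= nr z by rewrite -lecR -nrE normc_ge_Re.
have zi : `|complex.Im z| <= nr z.
  by have := normc_ge_Re (z * 'i); rewrite ReiNIm normrN normrM ni mulr1 nrE lecR.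
have [x xp zx] := real_net _ (le_trans zr zs).
have [y yp zy] := real_net _ (le_trans zi zs).
exists (Complex x y); first exact: allpairs_f.
have -> : z - Complex x y = (complex.Re z - x)%:C + 'i * (complex.Im z - y)%:C.
  by rewrite [z in LHS]complexE; case: z {zs zr zi zx zy} => u v; simpc.
apply: le_trans (nrD _ _) _; rewrite nrM.
have -> : nr ('i : C) = 1 by rewrite /nr ni.
rewrite mul1r; have rn (u : R) : nr u%:C = `|u|.
  by rewrite /nr normc_def /= expr0n /= addr0 sqrtr_sqr.
by rewrite !rn; rewrite /d in zx zy; lra.
Qed.

Lemma compact_rank1 phi (u : H) : bfun phi -> compact_op (fun x => phi x *: u).
Proof.
move=> [lphi [s s0 hs]]; apply/compact_opP; split.
  by move=> a x y; rewrite lphi scalerDl scalerA.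
move=> e e0; have nu : 0 < nr u + 1 by have := nr_ge0 u; lra.
have [|t ht] := @disc_net s (e / (nr u + 1)); first by rewrite divr_gt0.
exists [seq z *: u | z <- t] => x x1; have [|w wt pw] := ht (phi x).
  by rewrite (le_trans (hs x)) // -[leRHS]mulr1 ler_wpM2l.
exists (w *: u); first exact: map_f.
rewrite -scalerBl nrZ; apply: le_trans (_ : nr (phi x - w) * (nr u + 1) <= _).
  by rewrite ler_wpM2l ?nr_ge0 // lerDl.
by rewrite -ler_pdivlMr.
Qed.

End TotallyBounded.

(** * Inner products, one-dimensional projections, almost maximal vectors *)

Section Hilbert.
Context {R : realType}.
Local Notation C := R[i].
Variables (H : completeNormedModType C) (ip : H -> H -> C).
Hypothesis hip : is_inner_product ip.

Lemma conj_real (a : R) : (a%:C)^*%R = a%:C.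
Proof. by rewrite conj_Creal // realE (lecR 0 a) (lecR a 0) le_total. Qed.

Lemma ip_linl a x y z : ip (a *: x + y) z = a * ip x z + ip y z.
Proof. by case: hip. Qed.

Lemma ipC x y : ip y x = (ip x y)^*%R.
Proof. by case: hip. Qed.

Lemma ipxx x : ip x x = (nr x ^+ 2)%:C.
Proof. by case: hip => _ _ ->; rewrite rmorphXn /= -nrE. Qed.

Lemma ip0l y : ip 0 y = 0.
Proof. by have := ip_linl (-1) 0 0 y; rewrite scaler0 addr0 mulN1r addNr. Qed.

Lemma ipZl a x y : ip (a *: x) y = a * ip x y.
Proof. by have := ip_linl a x 0 y; rewrite ip0l !addr0. Qed.

Lemma ipDl x y z : ip (x + y) z = ip x z + ip y z.
Proof. by have := ip_linl 1 x y z; rewrite scale1r mul1r. Qed.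

Lemma ipBl x y z : ip (x - y) z = ip x z - ip y z.
Proof. by rewrite -scaleN1r ipDl ipZl mulN1r. Qed.

Lemma ip0r x : ip x 0 = 0.
Proof. by rewrite ipC ip0l rmorph0. Qed.

Lemma ip_eq0C x y : ip x y = 0 -> ip y x = 0.
Proof. by rewrite (ipC x y) => ->; rewrite rmorph0. Qed.

Lemma nr_pythag x y : ip x y = 0 -> nr (x + y) ^+ 2 = nr x ^+ 2 + nr y ^+ 2.
Proof.
move=> xy; apply: (@complexI R); rewrite -ipxx ipDl rmorphD /= -!ipxx.
by rewrite ![ip _ (x + y)]ipC !ipDl !rmorphD /= -!ipC xy (ip_eq0C xy) addr0 add0r.
Qed.

(* The zero vector pads orthonormal sequences when the rank is finite. *)
Definition unit0 (u : H) := u = 0 \/ nr u = 1.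

Lemma ip_proj0 u v : unit0 u -> ip (v - ip v u *: u) u = 0.
Proof.
move=> [->|u1]; first by rewrite ip0r.
by rewrite ipBl ipZl ipxx u1 expr1n mulr1 subrr.
Qed.

Lemma nr_proj u v : unit0 u ->
  nr (v - ip v u *: u) ^+ 2 = nr v ^+ 2 - nr (ip v u) ^+ 2.
Proof.
move=> u01; set w := v - _.
have -> : nr v ^+ 2 = nr w ^+ 2 + nr (ip v u *: u) ^+ 2.
  rewrite -nr_pythag ?subrK // ; apply: ip_eq0C.
  by rewrite ipZl (ip_eq0C (ip_proj0 v u01)) mulr0.
rewrite nrZ; case: u01 => [->|->]; last by rewrite mulr1 addrK.
by rewrite ip0r nr0 mul0r addrK.
Qed.

Lemma nr_ip_le u v : unit0 u -> nr (ip v u) <= nr v.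
Proof.
move=> u01; rewrite -ler_sqr ?nnegrE ?nr_ge0 // -subr_ge0 -nr_proj //.
by rewrite exprn_ge0 ?nr_ge0.
Qed.

Lemma nr_proj_le u v : unit0 u -> nr (v - ip v u *: u) <= nr v.
Proof.
move=> u01; rewrite -ler_sqr ?nnegrE ?nr_ge0 // nr_proj //.
by rewrite gerBl exprn_ge0 ?nr_ge0.
Qed.

Definition bdd (T : H -> H) := linear_op T /\ exists2 s : R, 0 <= s & op_le T s.

Lemma bfun_ip T u : bdd T -> unit0 u -> bfun (fun x => ip (T x) u).
Proof.
move=> [lT [s s0 /op_leP hs]] u01; split=> [a x y|].
  by rewrite lT ip_linl.
by exists s => // x; apply: le_trans (nr_ip_le _ u01) (hs x).
Qed.

(** The least bound rather than a supremum over the unit ball. For unbounded [T] the set is empty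
    and the value is 0, so being itself a bound requires [bdd T]. *)
Definition opnorm (T : H -> H) : R := inf [set s | 0 <= s /\ op_le T s].

Lemma opnorm_ge0 T : 0 <= opnorm T.
Proof.
rewrite /opnorm; set E := [set _ | _].
have [->|/set0P E0] := eqVneq E set0; first by rewrite inf0.
by apply: lb_le_inf => // s [].
Qed.

Lemma opnorm_le T s : 0 <= s -> op_le T s -> opnorm T <= s.
Proof. by move=> s0 Ts; apply: ge_inf => //; exists 0 => x []. Qed.

Lemma op_le_opnorm T : bdd T -> op_le T (opnorm T).
Proof.
move=> [_ [s s0 hs]]; apply/op_leP => x.
have [x0|x0] := eqVneq (nr x) 0; first by move/op_leP: hs => /(_ x); rewrite x0 !mulr0.
have nx : 0 < nr x by rewrite lt_neqAle nr_ge0 eq_sym x0.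
rewrite -ler_pdivrMr //; apply: lb_le_inf; first by exists s.
by move=> r [r0 /op_leP]; rewrite ler_pdivrMr.
Qed.

(** If no unit-ball vector reached half the norm, half the norm would already be a bound. The factor
    1/2 avoids proving that the norm is attained. *)
Lemma opnorm_attained T : bdd T -> 0 < opnorm T ->
  exists2 x, nr x <= 1 & opnorm T / 2 <= nr (T x).
Proof.
move=> [lT _] T0; apply: contrapT => /forall2NP h.
suff : op_le T (opnorm T / 2) by move=> /opnorm_le; lra.
apply: linear_bound => //; first lra.
by move=> x x1; have [//|/negP] := h x; rewrite -ltNge => /ltW.
Qed.

(** The vector [u] is a normalised value of [T], not an argument of it: being in the range of [T]
    gives the later vectors their orthogonality and their membership in the range of [c]. *)
Definition almost_top (T : H -> H) (u : H) :=
  (opnorm T = 0 /\ u = 0) \/ (0 < opnorm T /\ exists x,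
    [/\ nr x <= 1, opnorm T / 2 <= nr (T x) & u = (nr (T x))^-1%:C *: T x]).

Definition top_vec T : H := xget 0 (almost_top T).

Lemma top_vecP T : bdd T -> almost_top T (top_vec T).
Proof.
move=> bT; apply: (@xgetPex _ 0 (almost_top T)).
have := opnorm_ge0 T; rewrite le_eqVlt => /predU1P[T0|T0].
  by exists 0; left.
have [x x1 Tx] := opnorm_attained bT T0.
by exists ((nr (T x))^-1%:C *: T x); right; split => //; exists x.
Qed.

Lemma top_vec_unit T : bdd T -> 0 < opnorm T -> nr (top_vec T) = 1.
Proof.
move=> /top_vecP[[->]|[T0 [x [_ Tx ->]]]]; first by rewrite ltxx.
by rewrite nrZ nr_real ?invr_ge0 ?nr_ge0 // mulVf // gt_eqF //; lra.
Qed.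

Lemma top_vec0 T : bdd T -> opnorm T = 0 -> top_vec T = 0.
Proof. by move=> /top_vecP[[_ ->//]|[+ _] T0]; rewrite T0 ltxx. Qed.

Lemma top_vec_unit0 T : bdd T -> unit0 (top_vec T).
Proof.
move=> bT; have := opnorm_ge0 T; rewrite le_eqVlt => /predU1P[T0|T0].
  by left; apply: top_vec0.
by right; apply: top_vec_unit.
Qed.

(** * Greedy orthonormal vectors of a compact operator *)

Section Greedy.
Variable c : H -> H.
Hypothesis cc : compact_op c.

(* resid k is 1 - P_k, with P_k the projection on f_0, ..., f_(k-1); below,
   gvec k is f_k and gnorm k is t_k. *)
Fixpoint resid (k : nat) : H -> H :=
  if k is k'.+1 then fun v => resid k' v -
    ip (resid k' v) (top_vec (resid k' \o c)) *: top_vec (resid k' \o c)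
  else id.

Definition gvec k := top_vec (resid k \o c).
Definition gnorm k := opnorm (resid k \o c).

Lemma residS k v : resid k.+1 v = resid k v - ip (resid k v) (gvec k) *: gvec k.
Proof. by []. Qed.

Lemma comp_bdd T : linear_op T -> (forall v, nr (T v) <= nr v) -> bdd (T \o c).
Proof.
move=> lT hT; have [lc _] := cc; split=> [a x y /=|]; first by rewrite lc lT.
have [s s0 /op_leP hs] := compact_op_bounded cc.
by exists s => //; apply/op_leP => x /=; apply: le_trans (hT _) (hs x).
Qed.

Lemma resid_lin_le k : linear_op (resid k) /\ forall v, nr (resid k v) <= nr v.
Proof.
elim: k => [|k [lk hk]]; first by split.
have u01 : unit0 (gvec k) by apply: top_vec_unit0; apply: comp_bdd.
split=> [a x y|v]; last by rewrite residS (le_trans (nr_proj_le _ u01)).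
by rewrite !residS lk ip_linl scalerDl scalerBr scalerA opprD addrACA.
Qed.

Lemma resid_lin k : linear_op (resid k). Proof. by case: (resid_lin_le k). Qed.

Lemma resid_le k v : nr (resid k v) <= nr v.
Proof. by case: (resid_lin_le k). Qed.

Lemma residc_bdd k : bdd (resid k \o c).
Proof. by apply: comp_bdd; [exact: resid_lin|exact: resid_le]. Qed.

Lemma gvec_unit0 k : unit0 (gvec k).
Proof. exact: top_vec_unit0 (residc_bdd k). Qed.

Lemma gvecP k : almost_top (resid k \o c) (gvec k).
Proof. exact: top_vecP (residc_bdd k). Qed.

Lemma gnorm_ge0 k : 0 <= gnorm k. Proof. exact: opnorm_ge0. Qed.

Lemma resid_le_gnorm k x : nr (resid k (c x)) <= gnorm k * nr x.
Proof. by move: x; apply/op_leP/op_le_opnorm; exact: residc_bdd. Qed.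

Lemma gnormS k : gnorm k.+1 <= gnorm k.
Proof.
apply: opnorm_le; first exact: gnorm_ge0.
apply/op_leP => x; apply: le_trans (resid_le_gnorm k x).
by rewrite /= -/(gvec k) nr_proj_le //; exact: gvec_unit0.
Qed.

Lemma gnorm_le j k : (j <= k)%N -> gnorm k <= gnorm j.
Proof.
by move/subnK <-; elim: (k - j)%N => // m /(le_trans _); apply; exact: gnormS.
Qed.

(** The newest vector is removed by its projection. Removing it does not disturb the older
    relations, because [gvec k] is a multiple of some [resid k (c x)], which is orthogonal to the
    older vectors by induction. *)
Lemma resid_orth j k v : (j < k)%N -> ip (resid k v) (gvec j) = 0.
Proof.
elim: k j v => // k IH j v; rewrite ltnS leq_eqVlt => /predU1P[->|jk].
  by rewrite residS ip_proj0 //; exact: gvec_unit0.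
rewrite residS ipBl ipZl IH // sub0r.
have [[_ ->]|[_ [x [_ _ ->]]]] := gvecP k.
  by rewrite ip0l mulr0 oppr0.
by rewrite ipZl IH // !mulr0 oppr0.
Qed.

Lemma gvec_orth j k : j != k -> ip (gvec j) (gvec k) = 0.
Proof.
wlog jk : j k / (j < k)%N => [h jk|_].
  move: (jk); rewrite neq_ltn => /orP[/h->//|/h hk].
  by apply: ip_eq0C; apply: hk; rewrite eq_sym.
apply: ip_eq0C.
have [[_]|[_ [x [_ _]]]] := gvecP k => ->.
  by rewrite ip0l.
by rewrite ipZl resid_orth // mulr0.
Qed.

Lemma gvec_neq0 k : gvec k != 0 -> 0 < gnorm k.
Proof.
rewrite lt_neqAle gnorm_ge0 andbT; apply: contraNneq => g0.
by apply/eqP; apply: top_vec0; [exact: residc_bdd|rewrite -[LHS]g0].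
Qed.

Lemma gvec_unit k : 0 < gnorm k -> nr (gvec k) = 1.
Proof. exact: top_vec_unit (residc_bdd k). Qed.

(** As [gnorm] decreases, the nonzero vectors form an initial segment; this allows counting them
    against the rank. *)
Lemma gvec_unit_le j k : (j <= k)%N -> gvec k != 0 -> nr (gvec j) = 1.
Proof.
by move=> jk /gvec_neq0 k0; apply: gvec_unit; apply: lt_le_trans k0 (gnorm_le jk).
Qed.

(** Each vector subtracted is itself a value of [c], so the residual never leaves the range of [c],
    closed or not. *)
Lemma resid_range k x : exists y, resid k (c x) = c y.
Proof.
have [lc _] := cc; elim: k x => [|k IH] x; first by exists x.
have [y ry] := IH x.
have [z gz] : exists z, gvec k = c z.
  have [[_]|[_ [z [_ _]]]] := gvecP k => ->.
    by exists 0; rewrite linear_op0.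
  have [w rw] := IH z; exists ((nr (resid k (c z)))^-1%:C *: w).
  by rewrite /= rw (linear_opZ _ _ lc).
exists (y - ip (c y) (c z) *: z).
by rewrite residS ry gz (linear_opB _ _ lc) (linear_opZ _ _ lc).
Qed.

Lemma gvec_range k : exists y, gvec k = c y.
Proof.
have [lc _] := cc.
have [[_]|[_ [z [_ _]]]] := gvecP k => ->.
  by exists 0; rewrite linear_op0.
have [w rw] := resid_range k z; exists ((nr (resid k (c z)))^-1%:C *: w).
by rewrite /= rw (linear_opZ _ _ lc).
Qed.

Lemma gnorm_cvg0 (e : R) : 0 < e -> exists k, gnorm k <= e.
Proof.
move=> e0; apply: contrapT => /forallNP h.
have te k : e < gnorm k by rewrite ltNge; apply/negP.
have /choice[x hx] k : exists x, [/\ nr x <= 1, gnorm k / 2 <= nr (resid k (c x)) &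
    gvec k = (nr (resid k (c x)))^-1%:C *: resid k (c x)].
  have [[k0 _]|[_ [x hx]]] := gvecP k; last by exists x.
  by have := te k; rewrite /gnorm k0; lra.
(* [gvec j] is the normalised [resid j (c (x j))], so stage [j] removes this vector entirely. For
   [i < j], [resid j] then sends [c (x j) - c (x i)] to a vector longer than [e / 2]. *)
have rx j k : (j < k)%N -> resid k (c (x j)) = 0.
  elim: k => // k IH; rewrite ltnS leq_eqVlt => /predU1P[<-|jk]; last first.
    by rewrite residS IH // ip0l scale0r subr0.
  have [_ h1 h2] := hx j; rewrite residS.
  set v := resid j (c (x j)) in h1 h2 *.
  have v0 : 0 < nr v by have := te j; lra.
  have -> : ip v (gvec j) = (nr v)%:C.
    rewrite h2 ipC ipZl ipxx -rmorphM /= conj_real.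
    by rewrite expr2 mulrA mulVf ?mul1r // gt_eqF.
  by rewrite h2 scalerA -rmorphM /= mulfV ?gt_eqF // scale1r subrr.
have [_ tc] := (compact_opP c).1 cc.
have [|s hs] := tc (e / 8); first lra.
have /choice[y hy] k : exists y, y \in s /\ nr (c (x k) - y) <= e / 8.
  by have [x1 _ _] := hx k; have [y] := hs _ x1; exists y.
(* Pigeonhole: with one index more than net points, two of the [c (x k)] share a net point and lie
   within [e / 4]. *)
have : ~~ uniq [seq y k | k <- iota 0 (size s).+1].
  apply/negP => /uniq_leq_size us.
  have : {subset [seq y k | k <- iota 0 (size s).+1] <= s}.
    by move=> _ /mapP[k _ ->]; case: (hy k).
  by move=> /us; rewrite size_map size_iota ltnn.
move=> /(uniqPn 0)[i [j [ij]]]; rewrite size_map size_iota => js.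
have is_ := ltn_trans ij js.
rewrite !(nth_map 0%N) ?size_iota // !nth_iota // !add0n => yij.
have := nr_distD (y i) (c (x i)) (c (x j)); rewrite {2}yij (nr_distC (y j)).
have := resid_le j (c (x j) - c (x i)).
rewrite linear_opB; last exact: resid_lin.
rewrite (rx _ _ ij) subr0 (nr_distC (c (x j)) (c (x i))).
have [_ h1 _] := hx j; have [_ h2] := hy i; have [_ h3] := hy j; have := te j.
by lra.
Qed.

End Greedy.
End Hilbert.

(** * Limits in operator norm *)

Section Limits.
Context {R : realType}.
Local Notation C := R[i].
Variable H : completeNormedModType C.

(** One good index per tolerance replaces convergence to 0; this suffices when [e N] bounds a whole
    tail or a fixed quantity. *)
Definition small (e : nat -> R) := forall d : R, 0 < d -> exists N, e N <= d.

Lemma small_le0 (e : nat -> R) (K x : R) : 0 <= K -> small e ->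
  (forall N, x <= K * e N) -> x <= 0.
Proof.
move=> K0 se h; apply/ler_addgt0Pl => d d0; rewrite addr0.
have K1 : 0 < K + 1 by lra.
have [|N hN] := se (d / (K + 1)); first by rewrite divr_gt0.
apply: le_trans (h N) _; apply: le_trans (_ : K * (d / (K + 1)) <= _).
  by rewrite ler_wpM2l.
by rewrite mulrA ler_pdivrMr // mulrC ler_wpM2l ?lerDl // ltW.
Qed.

Lemma small_sqrt (e : nat -> R) : small e -> small (fun N => Num.sqrt (e N)).
Proof.
move=> se d d0; have [|N hN] := se (d ^+ 2); first by rewrite exprn_gt0.
by exists N; rewrite -(ger0_norm (ltW d0)) -sqrtr_sqr ler_wsqrtr.
Qed.

Lemma cauchy_lim (u : nat -> H) (e : nat -> R) :
  (forall N M, (N <= M)%N -> nr (u M - u N) <= e N) -> small e ->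
  exists l, forall N, nr (l - u N) <= e N.
Proof.
move=> hu se.
have cu : cvg (u @ \oo).
  apply: cauchy_cvg; apply/cauchyP => _ /ltC_real[r r0 ->].
  have [|N hN] := se (r / 2); first lra.
  exists (u N); exists N => // M /= /hu NM; 
  suff : ball (u N) r%:C (u M) by [].
  by rewrite nr_ball nr_distC; lra.
exists (lim (u @ \oo)) => N; apply/ler_addgt0Pl => d d0.
have : (u @ \oo) (ball (lim (u @ \oo)) d%:C).
  by apply: cu; apply: nbhsx_ballx; rewrite ltcR.
move=> [M _ hM].
have : ball (lim (u @ \oo)) d%:C (u (maxn M N)) by apply: hM; exact: leq_maxl.
rewrite nr_ball.
have := hu N (maxn M N) (leq_maxr _ _).
have := nr_distD (u (maxn M N)) (lim (u @ \oo)) (u N); lra.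
Qed.

(** The rate [e N * nr x] is uniform on the unit ball, so the pointwise limit is a norm limit and
    inherits compactness. Its linearity defect is bounded by a fixed multiple of every [e N], hence
    is 0. *)
Lemma op_lim (F : nat -> H -> H) (e : nat -> R) :
  (forall N, compact_op (F N)) ->
  (forall N M x, (N <= M)%N -> nr (F M x - F N x) <= e N * nr x) -> small e ->
  exists2 T, compact_op T & forall N x, nr (T x - F N x) <= e N * nr x.
Proof.
move=> cF hF se.
have /choice[T hT] x : exists l, forall N, nr (l - F N x) <= e N * nr x.
  apply: (cauchy_lim (u := F ^~ x)) => [N M NM|d d0]; first exact: hF.
  have n1 : 0 < nr x + 1 by have := nr_ge0 x; lra.
  have [|N hN] := se (d / (nr x + 1)); first by rewrite divr_gt0.
  exists N; apply: le_trans (_ : d / (nr x + 1) * nr x <= _).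
    by rewrite ler_wpM2r ?nr_ge0.
  rewrite mulrAC ler_pdivrMr // ler_wpM2l ?lerDl //; exact: ltW.
exists T => [|N x]; last exact: hT.
apply: compact_op_approx => [a x y|d /se[N hN]]; last first.
  exists (F N) => //; apply/op_leP => x; apply: le_trans (hT x N) _.
  by rewrite ler_wpM2r ?nr_ge0.
apply/eqP; rewrite -subr_eq0 -nr_eq0 eq_le nr_ge0 andbT.
apply: (@small_le0 e (nr (a *: x + y) + nr a * nr x + nr y)) => // [|N].
  by rewrite !addr_ge0 ?mulr_ge0 ?nr_ge0.
have [lF _] := cF N.
have -> : T (a *: x + y) - (a *: T x + T y) =
    (T (a *: x + y) - F N (a *: x + y)) - (a *: (T x - F N x) + (T y - F N y)).
  have -> : a *: (T x - F N x) + (T y - F N y) =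
      (a *: T x + T y) - (a *: F N x + F N y) by rewrite scalerBr addrACA -opprD.
  by rewrite lF opprB addrA subrK.
apply: le_trans (nrB _ _) _.
apply: le_trans (lerD (hT _ N) (le_trans (nrD _ _) (lerD (lexx _) (hT _ N)))) _.
rewrite nrZ; have := ler_wpM2l (nr_ge0 a) (hT x N); lra.
Qed.
End Limits.

(** * Factorization of one compact operator through a given orthonormal sequence *)

Section Factor.
Context {R : realType}.
Local Notation C := R[i].
Variables (H : completeNormedModType C) (ip : H -> H -> C).
Hypothesis hip : is_inner_product ip.

Definition ortho (g : nat -> H) :=
  (forall k, unit0 (g k)) /\ (forall j k, j != k -> ip (g j) (g k) = 0).

Lemma ip_suml m n (z : nat -> C) (g : nat -> H) y :
  ip (\sum_(m <= i < n) z i *: g i) y = \sum_(m <= i < n) z i * ip (g i) y.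
Proof.
elim/big_ind2: _ => [|x1 x2 y1 y2 <- <-|i _]; first exact: ip0l.
  exact: ipDl.
exact: ipZl.
Qed.

(** An inequality instead of the Pythagorean equality, since some [g i] may be 0. *)
Lemma nr_sum_ortho g (z : nat -> C) m n : ortho g ->
  nr (\sum_(m <= i < n) z i *: g i) ^+ 2 <= \sum_(m <= i < n) nr (z i) ^+ 2.
Proof.
move=> [g1 go]; elim: n => [|n IH]; first by rewrite !big_geq // nr0 expr0n.
have [mn|nm] := leqP m n; last by rewrite !big_geq // nr0 expr0n.
rewrite !big_nat_recr //= (nr_pythag hip).
  rewrite lerD // nrZ exprMn ler_piMr ?exprn_ge0 ?nr_ge0 //.
  by case: (g1 n) => ->; rewrite ?nr0 ?expr0n ?expr1n.
apply: ip_eq0C => //; rewrite ipZl // (ip_eq0C hip) ?mulr0 // ip_suml.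
rewrite big_nat big1 // => i /andP[_ i_n].
by rewrite go ?mulr0 // ltn_eqF.
Qed.

Lemma bessel g y n : ortho g -> \sum_(0 <= i < n) nr (ip y (g i)) ^+ 2 <= nr y ^+ 2.
Proof.
move=> [g1 go]; pose w n := y - \sum_(0 <= i < n) ip y (g i) *: g i.
suff hw : nr (w n) ^+ 2 = nr y ^+ 2 - \sum_(0 <= i < n) nr (ip y (g i)) ^+ 2.
  by rewrite -subr_ge0 -hw exprn_ge0 ?nr_ge0.
elim: n => [|n IH]; first by rewrite /w !big_geq // !subr0.
have wn : ip (w n) (g n) = ip y (g n).
  rewrite /w ipBl // ip_suml big_nat big1 ?subr0 // => i /andP[_ i_n].
  by rewrite go ?mulr0 // ltn_eqF.
have -> : w n.+1 = w n - ip (w n) (g n) *: g n.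
  by rewrite wn /w big_nat_recr //= opprD addrA.
by rewrite nr_proj // IH wn big_nat_recr //= opprD addrA.
Qed.

Lemma bessel_tail g y m n : ortho g ->
  \sum_(m <= i < n) nr (ip y (g i)) ^+ 2 <= nr y ^+ 2.
Proof.
move=> og; have [mn|nm] := leqP m n; last first.
  by rewrite big_geq ?exprn_ge0 ?nr_ge0 // ltnW.
apply: le_trans (bessel y n og); rewrite (@big_cat_nat _ _ _ m 0 n) //= lerDr.
by rewrite sumr_ge0 // => i _; rewrite exprn_ge0 ?nr_ge0.
Qed.

Variables (c : H -> H) (g : nat -> H).
Hypothesis (cc : compact_op c) (og : ortho g).
Local Notation f := (gvec ip c).
Local Notation t := (gnorm ip c).
Local Notation rho := (resid ip c).
(** Unit length is asked only where [f k] is nonzero: in finite dimension there may be no room for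
    further unit vectors. *)
Hypothesis hgf : forall k, f k != 0 -> nr (g k) = 1.

Lemma gvec_ortho : ortho f.
Proof. by split=> [k|j k]; [exact: gvec_unit0|exact: gvec_orth]. Qed.

Definition left_psum N y := \sum_(0 <= i < N) ((Num.sqrt (t i))%:C * ip y (g i)) *: f i.
(** The coefficient is [ip (c x) (f i)] written with the residual, the form whose squares telescope.
    When [t i = 0] the inverse is 0 by convention, and so is [f i]. *)
Definition right_psum N x :=
  \sum_(0 <= i < N) (((Num.sqrt (t i))^-1)%:C * ip (rho i (c x)) (f i)) *: g i.

Lemma bdd_id : bdd (id : H -> H).
Proof. by split=> //; exists 1 => //; apply/op_leP => x; rewrite mul1r. Qed.

Lemma compact_op_sum (F : nat -> H -> H) N : (forall i, compact_op (F i)) ->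
  compact_op (fun x => \sum_(0 <= i < N) F i x).
Proof.
move=> cF; elim: N => [|N IH].
  have -> : (fun x => \sum_(0 <= i < 0) F i x) = fun x => 0 *: F 0%N x.
    by apply/funext => x; rewrite big_geq // scale0r.
  exact: compact_opZ.
have -> : (fun x => \sum_(0 <= i < N.+1) F i x) =
    fun x => \sum_(0 <= i < N) F i x + F N x.
  by apply/funext => x; rewrite big_nat_recr.
exact: compact_opD.
Qed.

Lemma compact_left_psum N : compact_op (left_psum N).
Proof.
apply: compact_op_sum => i; under [X in compact_op X]funext => x do rewrite -scalerA.
by apply: compact_opZ; apply: compact_rank1; apply: (bfun_ip hip bdd_id); apply: og.1.
Qed.

Lemma compact_right_psum N : compact_op (right_psum N).
Proof.
apply: compact_op_sum => i; under [X in compact_op X]funext => x do rewrite -scalerA.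
apply: compact_opZ; apply: compact_rank1.
by apply: (bfun_ip hip (residc_bdd hip cc i)); apply: gvec_unit0.
Qed.

Lemma sqr_le_sqrt (x e y : R) : 0 <= x -> 0 <= e -> 0 <= y ->
  x ^+ 2 <= e * y ^+ 2 -> x <= Num.sqrt e * y.
Proof.
move=> x0 e0 y0 h; rewrite -ler_sqr ?nnegrE ?mulr_ge0 ?sqrtr_ge0 //.
by rewrite exprMn sqr_sqrtr.
Qed.

Lemma sub_bigN (F : nat -> H) N M : (N <= M)%N ->
  \sum_(0 <= i < M) F i - \sum_(0 <= i < N) F i = \sum_(N <= i < M) F i.
Proof. by move=> NM; rewrite (@big_cat_nat _ _ _ N 0 M) //= addrAC subrr add0r. Qed.

(** For [i >= N] the weight [t i] is at most [t N]; Bessel's inequality for [g] bounds the rest. *)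
Lemma left_psum_cauchy N M y : (N <= M)%N ->
  nr (left_psum M y - left_psum N y) <= Num.sqrt (t N) * nr y.
Proof.
move=> NM; apply: sqr_le_sqrt; rewrite ?nr_ge0 ?gnorm_ge0 // /left_psum sub_bigN //.
apply: le_trans (nr_sum_ortho _ _ _ gvec_ortho) _.
apply: le_trans (ler_wpM2l (gnorm_ge0 _ _ _) (bessel_tail y N M og)).
rewrite mulr_sumr big_nat [leRHS]big_nat; apply: ler_sum => i /andP[Ni _].
rewrite nrM nr_real ?sqrtr_ge0 // exprMn sqr_sqrtr ?gnorm_ge0 //.
by rewrite ler_wpM2r ?exprn_ge0 ?nr_ge0 // gnorm_le.
Qed.

(* With u_i = |rho_i (c x)|, the i-th coefficient of c x has square
   u_i^2 - u_(i+1)^2 and u_i <= t_i |x|; dividing by t_i makes the sum telescope. *)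
Lemma right_psum_cauchy N M x : (N <= M)%N ->
  nr (right_psum M x - right_psum N x) <= Num.sqrt (2 * t N) * nr x.
Proof.
move=> NM; apply: sqr_le_sqrt; rewrite ?nr_ge0 ?mulr_ge0 ?gnorm_ge0 //.
rewrite /right_psum sub_bigN //.
apply: le_trans (nr_sum_ortho _ _ _ og) _.
pose u i := nr (rho i (c x)).
apply: le_trans (_ : 2 * nr x * (u N - u M) <= _); last first.
  have := resid_le_gnorm hip cc N x; rewrite -/(u N) => uN.
  have := ler_wpM2l (nr_ge0 x) uN; have := mulr_ge0 (nr_ge0 x) (nr_ge0 (rho M (c x))).
  by rewrite -/(u M) expr2; lra.
rewrite -opprB -(telescope_sumr u NM) -sumrN mulr_sumr big_nat [leRHS]big_nat.
apply: ler_sum => i _; rewrite opprB nrM nr_real ?invr_ge0 ?sqrtr_ge0 //.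
rewrite exprMn exprVn sqr_sqrtr ?gnorm_ge0 //.
have hu : u i.+1 ^+ 2 = u i ^+ 2 - nr (ip (rho i (c x)) (f i)) ^+ 2.
  by rewrite /u residS nr_proj //; exact: gvec_unit0.
have ui : u i.+1 <= u i by rewrite /u residS nr_proj_le //; exact: gvec_unit0.
have := gnorm_ge0 ip c i; rewrite le_eqVlt => /predU1P[<-|t0].
  by rewrite invr0 mul0r !mulr_ge0 ?nr_ge0 // subr_ge0.
rewrite ler_pdivrMl //.
(* The second factor is at most [2 * (t i * nr x)], the source of the 2 in the bound for the right
   factor. *)
have -> : nr (ip (rho i (c x)) (f i)) ^+ 2 = (u i - u i.+1) * (u i + u i.+1).
  by rewrite -subr_sqr hu; ring.
have h1 := resid_le_gnorm hip cc i x; rewrite -/(u i) in h1.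
have h2 : 0 <= u i - u i.+1 by rewrite subr_ge0.
apply: le_trans (_ : (u i - u i.+1) * (2 * (t i * nr x)) <= _); last by lra.
by rewrite ler_wpM2l //; lra.
Qed.

(** Orthogonality of [g] leaves the diagonal terms, where the two square roots cancel; the remaining
    sum collects what the first [N] projections removed from [c x]. *)
Lemma psum_comp N x : left_psum N (right_psum N x) = c x - rho N (c x).
Proof.
have ipb i : (i < N)%N -> ip (right_psum N x) (g i) =
    ((Num.sqrt (t i))^-1)%:C * ip (rho i (c x)) (f i) * ip (g i) (g i).
  move=> iN; rewrite /right_psum ip_suml (bigD1_seq i) ?mem_index_iota ?iota_uniq //=.
  by rewrite big1 ?addr0 // => j ji; rewrite og.2 // mulr0.
transitivity (\sum_(0 <= i < N) ip (rho i (c x)) (f i) *: f i).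
  rewrite /left_psum big_nat [RHS]big_nat; apply: eq_bigr => i /andP[_ iN].
  rewrite ipb //; have [->|fi] := eqVneq (f i) 0; first by rewrite !scaler0.
  have t0 := gvec_neq0 hip cc fi.
  rewrite (ipxx hip) hgf // expr1n mulr1 mulrA -rmorphM /= mulfV ?mul1r //.
  by rewrite gt_eqF // sqrtr_gt0.
elim: N {ipb} => [|N IH]; first by rewrite big_geq //= subrr.
by rewrite big_nat_recr // IH residS opprB addrA addrAC.
Qed.

Lemma factor_block : exists a b : H -> H,
  [/\ compact_op a, compact_op b & a \o b = c] /\
  [/\ op_le a (Num.sqrt (opnorm c)), op_le b (Num.sqrt (2 * opnorm c)),
      forall q, (forall k, ip q (g k) = 0) -> a q = 0 &
      forall phi, bfun phi -> (forall k, phi (g k) = 0) -> forall x, phi (b x) = 0].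
Proof.
have st : small t by exact: gnorm_cvg0.
have sa := small_sqrt st.
have s2t : small (fun N => 2 * t N).
  by move=> d d0; have [|N hN] := st (d / 2); [lra|exists N; lra].
have sb := small_sqrt s2t.
have [a ca ha] := op_lim compact_left_psum left_psum_cauchy sa.
have [b cb hb] := op_lim compact_right_psum right_psum_cauchy sb.
have fa0 y : left_psum 0 y = 0 by rewrite /left_psum big_geq.
have fb0 y : right_psum 0 y = 0 by rewrite /right_psum big_geq.
exists a, b; split; split => //.
- apply/funext => x /=; apply/eqP; rewrite -subr_eq0 -nr_eq0 eq_le nr_ge0 andbT.
  pose K := nr (b x) + Num.sqrt (t 0) * (Num.sqrt 2 * nr x) + Num.sqrt (t 0) * nr x.
  apply: (@small_le0 _ (fun N => Num.sqrt (t N)) K) => // [|N].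
    by rewrite /K !addr_ge0 ?mulr_ge0 ?nr_ge0 ?sqrtr_ge0.
  (* Error of the left factor, error of the right factor under a partial sum, and the residual left
     by [psum_comp]; [K] collects the three constants. *)
  have -> : a (b x) - c x = (a (b x) - left_psum N (b x)) +
      left_psum N (b x - right_psum N x) - rho N (c x).
    have [lfa _] := compact_left_psum N.
    rewrite (linear_opB _ _ lfa) psum_comp opprB addrA subrK.
    by rewrite [in RHS]addrA addrAC addrK.
  apply: le_trans (nrB _ _) _; apply: le_trans (lerD (nrD _ _) (lexx _)) _.
  rewrite /K !mulrDl; apply: lerD; first apply: lerD.
  + by rewrite mulrC.
  + have := left_psum_cauchy (b x - right_psum N x) (leq0n N).
    rewrite fa0 subr0 => /le_trans; apply.
    rewrite -mulrA ler_wpM2l ?sqrtr_ge0 // (le_trans (hb N x)) //.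
    by rewrite sqrtrM // mulrAC.
  + apply: le_trans (resid_le_gnorm hip cc N x) _; rewrite mulrAC ler_wpM2r ?nr_ge0 //.
    (* [t N] is a product of two square roots; one is bounded by that of [t 0], so that all three
       errors scale like the other. *)
    rewrite -{1}(sqr_sqrtr (gnorm_ge0 ip c N)) expr2 ler_wpM2r ?sqrtr_ge0 //.
    by rewrite ler_wsqrtr // gnorm_le.
- by apply/op_leP => y; have := ha 0%N y; rewrite fa0 subr0.
- by apply/op_leP => y; have := hb 0%N y; rewrite fb0 subr0.
- move=> q hq; apply/eqP; rewrite -nr_eq0 eq_le nr_ge0 andbT.
  apply: (small_le0 (nr_ge0 q) sa) => N; rewrite mulrC; have := ha N q.
  by rewrite /left_psum big1 ?subr0 // => i _; rewrite hq mulr0 scale0r.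
- move=> phi [lphi [s s0 hs]] hg x; apply/eqP; rewrite -nr_eq0 eq_le nr_ge0 andbT.
  apply: (small_le0 (mulr_ge0 s0 (nr_ge0 x)) sb) => N.
  have phi0 : phi 0 = 0.
    by have := lphi (-1) 0 0; rewrite scaler0 addr0 mulN1r addNr.
  have phib : phi (right_psum N x) = 0.
    rewrite /right_psum; elim/big_ind: _ => // [y z hy hz|i _].
      by rewrite -[y]scale1r lphi hy hz mulr0 addr0.
    by rewrite -[_ *: _]addr0 lphi hg phi0 mulr0 addr0.
  have -> : phi (b x) = phi (b x - right_psum N x).
    by rewrite -[b x - _]addrC -scaleN1r lphi phib mulr0 add0r.
  by apply: le_trans (hs _) _; rewrite -mulrA ler_wpM2l // mulrC.
Qed.
End Factor.

(** * The dimension count and the placement of the orthonormal sequence *)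

Section Room.
Context {R : realType}.
Local Notation C := R[i].
Variables (H : completeNormedModType C) (ip : H -> H -> C).
Hypothesis hip : is_inner_product ip.

Definition indep n (e : nat -> H) := forall coef : nat -> C,
  \sum_(i < n) coef i *: e i = 0 -> forall i, (i < n)%N -> coef i = 0.

Definition scal (phi : H -> C) := forall a x y, phi (a *: x + y) = a * phi x + phi y.

Lemma scal_sum phi n (z : 'I_n -> C) (e : 'I_n -> H) : scal phi ->
  phi (\sum_i z i *: e i) = \sum_i z i * phi (e i).
Proof.
move=> lphi; have phi0 : phi 0 = 0.
  by have := lphi (-1) 0 0; rewrite scaler0 addr0 mulN1r addNr.
apply: (big_ind2 (fun x y => phi x = y)) => // [x1 x2 y1 y2 <- <-|i _].
  by have := lphi 1 x1 y1; rewrite scale1r mul1r.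
by rewrite -[_ *: _]addr0 lphi phi0 addr0.
Qed.

Lemma left_kernel n m (A : 'M[C]_(n, m)) : (m < n)%N ->
  exists2 u : 'rV[C]_n, u != 0 & u *m A = 0.
Proof.
move=> mn; have : kermx A != 0.
  rewrite kermx_eq0 /row_free; apply/eqP => rA.
  by have := rank_leq_col A; rewrite rA leqNgt mn.
by move=> /rowV0Pn[u /sub_kermxP uA u0]; exists u.
Qed.

Lemma indep_row n e (u : 'rV[C]_n) : indep n e ->
  \sum_(i < n) u 0 i *: e i = 0 -> u = 0.
Proof.
move=> he hu; pose coef k := if insub k is Some i then u 0 i else 0.
have cE (i : 'I_n) : coef i = u 0 i by rewrite /coef valK.
apply/rowP => i; rewrite mxE -cE; apply: he (ltn_ord i).
by rewrite -[RHS]hu; apply: eq_bigr => j _; rewrite cE.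
Qed.

Lemma kernel_vec n m e (phi : nat -> H -> C) : indep n e -> (m < n)%N ->
  (forall j, scal (phi j)) -> exists2 v, v != 0 & forall j, (j < m)%N -> phi j v = 0.
Proof.
move=> he mn lphi.
have [u u0 uA] := left_kernel (\matrix_(i < n, j < m) phi j (e i)) mn.
exists (\sum_(i < n) u 0 i *: e i).
  by apply: contra_neq u0 => /(indep_row he).
move=> j jm; rewrite scal_sum //; have /rowP/(_ (Ordinal jm)) := uA.
by rewrite !mxE => uj; rewrite -[RHS]uj; apply: eq_bigr => i _; rewrite mxE.
Qed.

Lemma indep_leq n r (e : nat -> H) (w : 'I_r -> H) : indep n e ->
  (forall k, exists z : 'I_r -> C, e k = \sum_i z i *: w i) -> (n <= r)%N.
Proof.
move=> he /choice[z hz]; rewrite leqNgt; apply/negP => rn.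
have [u u0 uA] := left_kernel (\matrix_(i < n, j < r) z i j) rn.
case/eqP: u0; apply: (indep_row he).
under eq_bigr => i _ do rewrite hz scaler_sumr.
rewrite exchange_big big1 //= => j _; under eq_bigr => i _ do rewrite scalerA.
rewrite -scaler_suml; have /rowP/(_ j) := uA; rewrite !mxE => uj.
suff -> : \sum_(i < n) u 0 i * z i j = 0 by rewrite scale0r.
by rewrite -[RHS]uj; apply: eq_bigr => i _; rewrite mxE.
Qed.

Lemma has_dim_indep n : has_dim H n -> exists e, indep n e.
Proof.
move=> [e [he _]]; exists (fun k => if insub k is Some i then e i else 0) => coef hc i ni.
have /he/(_ (Ordinal ni)) // : \sum_(j < n) coef j *: e j = 0.
by rewrite -[RHS]hc; apply: eq_bigr => j _; rewrite valK.
Qed.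

(** An independent family that could not be extended by one vector would be a basis. *)
Lemma infinite_indep n : ~ finite_dim H -> exists e, indep n e.
Proof.
move=> inf; elim: n => [|n [e he]]; first by exists (fun=> 0).
have [x hx] : exists x, forall coef : 'I_n -> C, x <> \sum_(i < n) coef i *: e i.
  apply: contrapT => /forallNP h; apply: inf; exists n, (fun i => e i); split.
    move=> coef hc i; have := @indep_row n e (\row_j coef j) he.
    under eq_bigr => j _ do rewrite mxE.
    by move=> /(_ hc)/rowP/(_ i); rewrite !mxE.
  by move=> x; apply: contrapT => hx; apply: (h x) => coef xE; apply: hx; exists coef.
exists (fun k => if k == n then x else e k) => coef.
rewrite big_ord_recr /= eqxx; under eq_bigr => i _ do rewrite ltn_eqF //.
move=> hs; have cn : coef n = 0.
  apply/eqP; apply: contrapT => /negP cn; apply: (hx (fun i => - (coef n)^-1 * coef i)).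
  move/eqP: hs; rewrite addrC addr_eq0 => /eqP hs.
  rewrite -[LHS](scalerK cn) hs scalerN -scaleNr scaler_sumr; apply: eq_bigr => i _.
  by rewrite scalerA.
move: hs; rewrite cn scale0r addr0 => /he h i.
by rewrite ltnS leq_eqVlt => /predU1P[->|/h].
Qed.

Lemma indepW m n e : (m <= n)%N -> indep n e -> indep m e.
Proof.
move=> mn he coef hc i im.
have := he (fun k => if (k < m)%N then coef k else 0) _ i (leq_trans im mn).
rewrite im; apply; rewrite -[RHS]hc (big_ord_widen _ (fun i => coef i *: e i) mn).
by rewrite [RHS]big_mkcond; apply: eq_bigr => j _; case: ifP => // _; rewrite scale0r.
Qed.

Lemma ortho_indep n g : ortho ip g -> (forall k, (k < n)%N -> nr (g k) = 1) -> indep n g.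
Proof.
move=> [_ go] g1 coef hc i i_n; have : ip (\sum_(j < n) coef j *: g j) (g i) = 0.
  by rewrite hc ip0l.
have lg : scal (ip^~ (g i)) by move=> a x y; exact: ip_linl.
have /= -> := @scal_sum (ip^~ (g i)) n (fun j => coef j) (fun j => g j) lg.
rewrite (bigD1 (Ordinal i_n)) //= big1 ?addr0; last first.
  by move=> j ji; rewrite go ?mulr0 //.
by rewrite (ipxx hip) g1 // expr1n mulr1.
Qed.

Definition has_room (c : H -> H) := ~ finite_dim H \/
  exists n, [/\ has_dim H n, (2 <= n)%N & rank_le c (n - 2)].

(** In finite dimension [n], the vectors [gvec 0] to [gvec k] are orthonormal in the range of [c],
    so [k + 1 <= n - 2]. *)
Lemma room_indep c k : compact_op c -> has_room c -> gvec ip c k != 0 ->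
  exists e, indep k.+3 e.
Proof.
move=> cc [inf _|[n [dn n2 [w hw]]] gk]; first exact: infinite_indep.
have kn : (k.+1 <= n - 2)%N.
  apply: (@indep_leq _ _ (gvec ip c) w).
    apply: ortho_indep; first exact: gvec_ortho.
    by move=> j jk; apply: (gvec_unit_le hip cc _ gk).
  by move=> j; have [y ->] := gvec_range hip cc j; exact: hw.
have [e he] := has_dim_indep dn; exists e; apply: indepW he.
by rewrite -(subnK n2) addn2 !ltnS.
Qed.

Lemma room_unit c : has_room c -> exists v : H, nr v = 1.
Proof.
move=> hc; suff [v v0] : exists v : H, v != 0.
  exists ((nr v)^-1%:C *: v); rewrite nrZ nr_real ?invr_ge0 ?nr_ge0 //.
  by rewrite mulVf // nr_eq0.
have [e he] : exists e, indep 1 e.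
  case: hc => [|[n [dn n2 _]]]; first exact: infinite_indep.
  have [e he] := has_dim_indep dn; exists e; apply: indepW he; exact: ltnW.
exists (e 0%N); apply/eqP => e0; have := he (fun=> 1); rewrite big_ord1 e0 scaler0.
by move=> /(_ erefl 0%N isT)/eqP; rewrite oner_eq0.
Qed.

Section Avoid.
Variables (phi : H -> C) (q : H).
Hypothesis bphi : bfun phi.

Definition avoiding (s : seq H) : set H :=
  [set v | [/\ nr v = 1, phi v = 0, ip v q = 0 & forall w, w \in s -> ip v w = 0]].

(** The list of earlier choices. When no candidate remains, [xget] returns 0, which is still
    orthogonal to everything and in the kernel of [phi]. *)
Fixpoint avoid_seq k : seq H :=
  if k is k'.+1 then rcons (avoid_seq k') (xget 0 (avoiding (avoid_seq k')))
  else [::].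

Definition avoid_vec k := xget 0 (avoiding (avoid_seq k)).

Lemma avoid_vecP k : avoid_vec k = 0 \/ avoiding (avoid_seq k) (avoid_vec k).
Proof.
have [ex|nex] := pselect (exists v, avoiding (avoid_seq k) v); last first.
  by left; apply: xgetPN => v hv; apply: nex; exists v.
by right; case: ex => v; exact: xgetI.
Qed.

Lemma mem_avoid_seq j k : (j < k)%N -> avoid_vec j \in avoid_seq k.
Proof.
elim: k => // k IH; rewrite ltnS leq_eqVlt /= mem_rcons inE => /predU1P[->|/IH ->].
  by rewrite eqxx.
by rewrite orbT.
Qed.

Lemma size_avoid_seq k : size (avoid_seq k) = k.
Proof. by elim: k => //= k IH; rewrite size_rcons IH. Qed.

Lemma avoid_ortho : ortho ip avoid_vec.
Proof.
split=> [k|j k]; first by case: (avoid_vecP k) => [->|[]]; [left|right].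
wlog jk : j k / (k < j)%N => [h jk|_].
  move: (jk); rewrite neq_ltn => /orP[kj|/h->//].
  by apply: ip_eq0C => //; apply: h; rewrite // eq_sym.
case: (avoid_vecP j) => [->|[_ _ _ h]]; first by rewrite ip0l.
by apply: h; exact: mem_avoid_seq.
Qed.

Lemma avoid_phi k : phi (avoid_vec k) = 0.
Proof.
case: (avoid_vecP k) => [->|[]//].
by case: bphi => lphi _; have := lphi (-1) 0 0; rewrite scaler0 addr0 mulN1r addNr.
Qed.

Lemma avoid_q k : ip q (avoid_vec k) = 0.
Proof.
by case: (avoid_vecP k) => [->|[_ _ h _]]; [rewrite ip0r|exact: ip_eq0C].
Qed.

Lemma avoid_unit k : (exists e, indep k.+3 e) -> nr (avoid_vec k) = 1.
Proof.
move=> [e he].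
suff [v hv] : avoiding (avoid_seq k) !=set0.
  by have [] : avoiding (avoid_seq k) (avoid_vec k) by exact: xgetI hv.
(* All [k + 2] conditions in one sequence: [phi], then [q], then the [k] earlier vectors. They have
   a common nonzero solution among [k + 3] independent vectors. *)
pose psi j : H -> C := if j is j'.+1 then if j' is j''.+1 then
  ip^~ (nth 0 (avoid_seq k) j'') else ip^~ q else phi.
have lpsi j : scal (psi j).
  case: j => [|[|j]]; first by case: bphi.
    by move=> a x y; exact: ip_linl.
  by move=> a x y; exact: ip_linl.
have [v v0 hv] := kernel_vec he (ltnSn k.+2) lpsi.
have psiZ j a : (j < k.+2)%N -> psi j (a *: v) = 0.
  move=> jk; rewrite -[_ *: _]addr0 lpsi hv // mulr0 add0r.
  by have := lpsi j (-1) 0 0; rewrite scaler0 addr0 mulN1r addNr.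
exists ((nr v)^-1%:C *: v); split.
- rewrite nrZ nr_real ?invr_ge0 ?nr_ge0 //; by rewrite mulVf // nr_eq0.
- exact: (psiZ 0%N).
- exact: (psiZ 1%N).
move=> w ws; have /= := psiZ (index w (avoid_seq k)).+2 (nr v)^-1%:C.
by rewrite nth_index // => ->//; rewrite !ltnS -[ltnRHS](size_avoid_seq k) index_mem.
Qed.
End Avoid.

Lemma factor_room c phi q : compact_op c -> has_room c -> bfun phi ->
  exists a b : H -> H,
  [/\ compact_op a, compact_op b & a \o b = c] /\
  [/\ op_le a (Num.sqrt (opnorm c)), op_le b (Num.sqrt (2 * opnorm c)),
      a q = 0 & forall x, phi (b x) = 0].
Proof.
move=> cc hc bphi.
have [k gk|a [b [h [ha hb aq bp]]]] := factor_block hip cc (avoid_ortho phi q).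
  by apply: avoid_unit => //; exact: room_indep gk.
exists a, b; split=> //; split=> //.
  by apply: aq => k; exact: avoid_q.
by apply: bp => // k; exact: avoid_phi.
Qed.

(** Taking [g] to be the greedy sequence itself costs no room, so this factorization has no rank
    restriction. *)
Lemma factor_op c : compact_op c -> exists a b : H -> H,
  [/\ compact_op a, compact_op b & a \o b = c] /\
  op_le a (Num.sqrt (opnorm c)) /\ op_le b (Num.sqrt (2 * opnorm c)).
Proof.
move=> cc; have [k gk|a [b [h [ha hb _ _]]]] := factor_block hip cc (gvec_ortho hip cc).
  by apply: gvec_unit => //; exact: gvec_neq0.
by exists a, b.
Qed.
End Room.

(** * The c0-sum: algebra operations, factorization, approximate units *)

Section C0Sum.
Context {R : realType}.
Local Notation C := R[i].
Variables (L : Type) (H : L -> completeNormedModType C).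
Local Notation Elt := (Elt H).
Implicit Types a b c u : Elt.

Lemma op_leW (E : normedModType C) (f : E -> E) s t : s <= t -> op_le f s -> op_le f t.
Proof.
move=> st /op_leP hs; apply/op_leP => v; apply: le_trans (hs v) _.
by rewrite ler_wpM2r ?nr_ge0.
Qed.

Lemma op_le0 (E : normedModType C) s : 0 <= s -> op_le (fun _ : E => 0) s.
Proof. by move=> s0; apply/op_leP => v; rewrite nr0 mulr_ge0 ?nr_ge0. Qed.

Lemma op_leD (E : normedModType C) (f g : E -> E) s t :
  op_le f s -> op_le g t -> op_le (fun v => f v + g v) (s + t).
Proof.
move=> /op_leP hf /op_leP hg; apply/op_leP => v.
by rewrite mulrDl (le_trans (nrD _ _)) // lerD.
Qed.

Lemma op_leZ (E : normedModType C) (f : E -> E) k s :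
  op_le f s -> op_le (fun v => k *: f v) (nr k * s).
Proof.
by move=> /op_leP hf; apply/op_leP => v; rewrite nrZ -mulrA ler_wpM2l ?nr_ge0.
Qed.

Lemma op_le_comp (E : normedModType C) (f g : E -> E) s t : 0 <= s ->
  op_le f s -> op_le g t -> op_le (f \o g) (s * t).
Proof.
move=> s0 /op_leP hf /op_leP hg; apply/op_leP => v /=.
by rewrite (le_trans (hf _)) // -mulrA ler_wpM2l.
Qed.

Lemma compact_op0 (E : completeNormedModType C) : compact_op (fun _ : E => 0).
Proof.
rewrite (_ : (fun _ : E => 0) = fun v => (fun=> 0 : C) v *: (0 : E)); last first.
  by apply/funext => v; rewrite scaler0.
apply: compact_rank1; split; first by move=> *; rewrite mulr0 addr0.
by exists 0 => // v; rewrite nr0 mul0r.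
Qed.

(** [L] is a bare type; [List.In] needs no equality test and permits induction over the exceptional
    coordinates. *)
Lemma finite_listP (A : set L) : finite_set A -> exists s, forall l, A l -> List.In l s.
Proof.
move=> /(@finite_seqP {classic L})[s ->]; exists s => l /=.
by elim: s => //= m s IH; rewrite inE => /predU1P[->|/IH]; [left|right].
Qed.

Lemma inA_lin a l : inA a -> linear_op (a l). Proof. by move=> [/(_ l)[]]. Qed.

Lemma inA_dom a b : (forall l, compact_op (b l)) -> inA a ->
  (forall e : R, 0 < e -> exists2 d : R, 0 < d &
     forall l, op_le (a l) d -> op_le (b l) e) -> inA b.
Proof.
move=> cb [_ ha] h; split=> // e /h[d /ha fina hd].
by apply: sub_finite_set fina => l /= nb na; apply: nb; exact: hd.
Qed.

Lemma inA_add a b : inA a -> inA b -> inA (addA a b).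
Proof.
move=> [ca ha] [cb hb]; split=> [l|e e0]; first exact: compact_opD.
have e2 : 0 < e / 2 by lra.
have : finite_set ([set l | ~ op_le (a l) (e / 2)] `|` [set l | ~ op_le (b l) (e / 2)]).
  by rewrite finite_setU; split; [exact: ha|exact: hb].
apply: sub_finite_set => l /= nab; apply: contrapT => /not_orP[/contrapT h1 /contrapT h2].
by apply: nab; apply: op_leW (op_leD h1 h2); lra.
Qed.

Lemma inA_scale k a : inA a -> inA (scaleA k a).
Proof.
move=> ha; apply: (inA_dom _ ha) => [l|e e0]; first by apply: compact_opZ; case: ha.
have nk : 0 < nr k + 1 by have := nr_ge0 k; lra.
exists (e / (nr k + 1)) => [|l /(op_leZ k)]; first by rewrite divr_gt0.
apply: op_leW; rewrite mulrA ler_pdivrMr // mulrC ler_wpM2l //; lra.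
Qed.

Lemma inA_lincomb k a b : inA a -> inA b -> inA (addA (scaleA k a) b).
Proof. by move=> ha hb; apply: inA_add => //; exact: inA_scale. Qed.

Lemma inA_bounded a : inA a -> exists2 s : R, 0 <= s & normA_le a s.
Proof.
move=> [ca /(_ 1 ltr01)/finite_listP[s hs]].
suff [B B0 hB] : exists2 B : R, 0 <= B & forall l, List.In l s -> op_le (a l) B.
  exists (B + 1) => [|l]; first by rewrite addr_ge0.
  have [h|/hs/hB] := pselect (op_le (a l) 1); last by apply: op_leW; lra.
  by apply: op_leW h; lra.
elim: s {hs} => [|l s [B B0 hB]]; first by exists 0.
have [t t0 ht] := compact_op_bounded (ca l).
exists (B + t) => [|m /= [<-|/hB]]; first by rewrite addr_ge0.
  by apply: op_leW ht; rewrite lerDr.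
by apply: op_leW; rewrite lerDl.
Qed.

Lemma normA_le_mul a b s t : 0 <= s -> normA_le a s -> normA_le b t ->
  normA_le (mulA a b) (s * t).
Proof. by move=> s0 ha hb l; exact: op_le_comp. Qed.

Lemma inA_mul a b : inA a -> inA b -> inA (mulA a b).
Proof.
move=> ha hb; have [s s0 hs] := inA_bounded hb.
apply: (inA_dom _ ha) => [l|e e0].
  by apply: compact_op_comp (hs l); [case: ha|exact: inA_lin].
exists (e / (s + 1)) => [|l hl]; first by rewrite divr_gt0 // ltr_wpDl.
have s1 : 0 < s + 1 by lra.
apply: op_leW (op_le_comp (ltW _) hl (hs l)); last by rewrite divr_gt0.
by rewrite mulrAC ler_pdivrMr // ler_wpM2l ?lerDl // ltW.
Qed.

Definition maskA (P : L -> Prop) a : Elt := fun l v => if `[< P l >] then a l v else 0.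
Arguments maskA P a l v : clear implicits.

Lemma maskAT (P : L -> Prop) a l : P l -> maskA P a l = a l.
Proof. by move=> Pl; apply/funext => v; rewrite /maskA asboolT. Qed.

Lemma maskAF (P : L -> Prop) a l : ~ P l -> maskA P a l = fun=> 0.
Proof. by move=> Pl; apply/funext => v; rewrite /maskA asboolF. Qed.

Lemma maskA_split P a : a = addA (maskA P a) (maskA (fun l => ~ P l) a).
Proof.
apply/functional_extensionality_dep => l; apply/funext => v; rewrite /addA.
have [Pl|nPl] := pselect (P l).
  by rewrite maskAT // maskAF ?addr0 // => /(_ Pl).
by rewrite maskAF // maskAT // add0r.
Qed.

Lemma compact_maskA P a l : (P l -> compact_op (a l)) -> compact_op (maskA P a l).
Proof.
move=> h; have [Pl|nPl] := pselect (P l); first by rewrite maskAT //; exact: h.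
by rewrite maskAF //; exact: compact_op0.
Qed.

Lemma op_le_maskA P a l s : 0 <= s -> (P l -> op_le (a l) s) -> op_le (maskA P a l) s.
Proof.
move=> s0 h; have [Pl|nPl] := pselect (P l); first by rewrite maskAT //; exact: h.
by rewrite maskAF //; exact: op_le0.
Qed.

Lemma inA_mask_finite (P : L -> Prop) a : finite_set [set l | P l] ->
  (forall l, compact_op (a l)) -> inA (maskA P a).
Proof.
move=> fP ca; split=> [l|e e0]; first by apply: compact_maskA => _.
apply: sub_finite_set fP => l /= nl; apply: contrapT => nP; apply: nl.
by apply: op_le_maskA => //; exact: ltW.
Qed.

Lemma inA_mask P a : inA a -> inA (maskA P a).
Proof.
move=> ha; apply: (inA_dom _ ha) => [l|e e0].
  by apply: compact_maskA => _; case: ha.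
by exists e => // l hl; apply: op_le_maskA => //; exact: ltW.
Qed.

(* Taking p and g as families over L avoids transport along l = m. *)
Definition rk (l : L) (p : forall m, H m) (g : forall m, H m -> C) : Elt :=
  maskA (eq l) (fun m v => g m v *: p m).
Arguments rk l p g l v : clear implicits, rename.

Lemma finite_eq (l : L) : finite_set [set m | l = m].
Proof.
apply: (@sub_finite_set _ _ [set l]); last exact: finite_set1.
by move=> m /= ->.
Qed.

Lemma inA_rk l p g : (forall m, bfun (g m)) -> inA (rk l p g).
Proof.
by move=> bg; apply: inA_mask_finite (finite_eq l) _ => m; exact: compact_rank1.
Qed.

Variable ip : forall l : L, H l -> H l -> C.
Arguments ip : clear implicits.
Hypothesis hip : forall l, is_inner_product (ip l).

(** Square roots of norms tending to 0 tend to 0. The left factor uses [k = 1], the right one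
    [k = 2]. *)
Lemma inA_sqrt (k : R) c a : 0 < k -> inA c -> (forall l, compact_op (a l)) ->
  (forall l, op_le (a l) (Num.sqrt (k * opnorm (c l)))) -> inA a.
Proof.
move=> k0 ic ca ha; apply: (inA_dom ca ic) => e e0.
exists (e ^+ 2 / k) => [|l hl]; first by rewrite divr_gt0 ?exprn_gt0.
apply: op_leW (ha l); rewrite -(ger0_norm (ltW e0)) -sqrtr_sqr ler_wsqrtr //.
by rewrite mulrC -ler_pdivlMr // opnorm_le // divr_ge0 ?exprn_ge0 // ltW.
Qed.

Lemma factorA_gen c (P : forall l, (H l -> H l) -> (H l -> H l) -> Prop) : inA c ->
  (forall l, exists a b : H l -> H l,
     [/\ compact_op a, compact_op b & a \o b = c l] /\
     [/\ op_le a (Num.sqrt (opnorm (c l))), op_le b (Num.sqrt (2 * opnorm (c l))) &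
      P l a b]) ->
  exists a b, [/\ inA a, inA b, mulA a b = c & forall l, P l (a l) (b l)].
Proof.
move=> ic h.
have {}h l : exists ab : (H l -> H l) * (H l -> H l),
     [/\ compact_op ab.1, compact_op ab.2 & ab.1 \o ab.2 = c l] /\
     [/\ op_le ab.1 (Num.sqrt (opnorm (c l))),
         op_le ab.2 (Num.sqrt (2 * opnorm (c l))) & P l ab.1 ab.2].
  by have [a [b hab]] := h l; exists (a, b).
pose ab l := projT1 (cid (h l)); have abP l := projT2 (cid (h l)).
exists (fun l => (ab l).1), (fun l => (ab l).2); split.
- apply: (@inA_sqrt 1 c) => // l; first by case: (abP l) => -[].
  by rewrite mul1r; case: (abP l) => _ [].
- by apply: (@inA_sqrt 2 c) => // l; [case: (abP l) => -[]|case: (abP l) => _ []].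
- by apply/functional_extensionality_dep => l; case: (abP l) => -[].
- by move=> l; case: (abP l) => _ [].
Qed.

Lemma factorA c : inA c -> exists a b, [/\ inA a, inA b & mulA a b = c].
Proof.
move=> ic; have [|a [b [ia ib ab _]]] := @factorA_gen c (fun _ _ _ => True) ic.
  move=> l; have cl : compact_op (c l) by case: ic.
  have [a [b [h [h1 h2]]]] := factor_op (hip l) cl.
  by exists a, b.
by exists a, b.
Qed.

Lemma factorA_avoid c (phi : forall l, H l -> C) (q : forall l, H l) :
  inA c -> (forall l, has_room (c l)) -> (forall l, bfun (phi l)) ->
  exists a b, [/\ inA a, inA b, mulA a b = c &
    forall l, a l (q l) = 0 /\ forall x, phi l (b l x) = 0].
Proof.
move=> ic rc bphi; have cc l : compact_op (c l) by case: ic.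
pose P l (a b : H l -> H l) := a (q l) = 0 /\ forall x, phi l (b x) = 0.
have [l|a [b [ia ib ab Pab]]] := @factorA_gen c P ic; last by exists a, b.
have [a [b [h [h1 h2 h3 h4]]]] := factor_room (hip l) (q l) (cc l) (rc l) (bphi l).
by exists a, b.
Qed.

Lemma compact_residc l (c : H l -> H l) k : compact_op c ->
  compact_op (fun v => resid (ip l) c k (c v)).
Proof.
move=> cc; elim: k => [//|k IH].
rewrite (_ : (fun v => _) = fun v => resid (ip l) c k (c v) +
    (-1) *: (ip l (resid (ip l) c k (c v)) (gvec (ip l) c k) *:
             gvec (ip l) c k)); last first.
  by apply/funext => v; rewrite residS scaleN1r.
apply: compact_opD => //; apply: compact_opZ; apply: compact_rank1.
by apply: (bfun_ip (hip l) (residc_bdd (hip l) cc k)); exact: gvec_unit0.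
Qed.

Lemma compact_cresid l (c : H l -> H l) k : compact_op c ->
  compact_op (fun v => v - resid (ip l) c k v).
Proof.
move=> cc; elim: k => [|k IH].
  by under [X in compact_op X]funext => v do rewrite subrr; exact: compact_op0.
rewrite (_ : (fun v => _) = fun v => (v - resid (ip l) c k v) +
    ip l (resid (ip l) c k v) (gvec (ip l) c k) *: gvec (ip l) c k); last first.
  by apply/funext => v; rewrite residS opprB addrA addrAC.
apply: compact_opD => //; apply: compact_rank1.
apply: (bfun_ip (hip l)); last exact: gvec_unit0.
split; first exact: resid_lin.
by exists 1 => //; apply/op_leP => v; rewrite mul1r; exact: resid_le.
Qed.

(** Bounding [1 - u] instead of [u] gives a property stable under composing the operators [1 - u],
    as needed for approximating several elements at once. *)
Definition co_contraction u := inA u /\ forall l v, nr (v - u l v) <= nr v.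

(** The unit is the greedy projection on the finitely many coordinates where [a l] exceeds [e], and
    0 elsewhere. *)
Lemma approx_unit1 a (e : R) : inA a -> 0 < e ->
  exists2 u, co_contraction u & forall l x, nr (a l x - u l (a l x)) <= e * nr x.
Proof.
move=> ia e0; have ca l : compact_op (a l) by case: ia.
have /choice[k hk] l : exists k, gnorm (ip l) (a l) k <= e by exact: gnorm_cvg0.
pose P l := ~ op_le (a l) e.
pose w : Elt := fun l v => v - resid (ip l) (a l) (k l) v.
exists (maskA P w); first split.
- apply: inA_mask_finite; first by case: ia => _; apply.
  by move=> l; exact: compact_cresid.
- move=> l v; have [Pl|nPl] := pselect (P l); last by rewrite maskAF // subr0.
  by rewrite maskAT // /w opprB addrC subrK; exact: resid_le.
move=> l x; have [Pl|nPl] := pselect (P l).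
  rewrite maskAT // /w opprB addrC subrK.
  apply: le_trans (resid_le_gnorm (hip l) (ca l) _ _) _.
  by rewrite ler_wpM2r ?nr_ge0.
by rewrite maskAF // subr0; move/contrapT: nPl => /op_leP.
Qed.

Lemma approx_unit n (a : nat -> Elt) (e : R) : (forall i, inA (a i)) -> 0 < e ->
  exists2 u, co_contraction u & forall i l x, (i < n)%N ->
    nr (a i l x - u l (a i l x)) <= e * nr x.
Proof.
move=> ia e0; elim: n => [|n [u [iu cu] hu]].
  by have [u] := approx_unit1 (ia 0%N) e0; exists u.
have ian : inA (addA (scaleA (-1) (mulA u (a n))) (a n)).
  by apply: inA_lincomb => //; exact: inA_mul.
have [w [iw cw] hw] := approx_unit1 ian e0.
(* Chosen so that [1 - z = (1 - w)(1 - u)]: [w] handles what [u] leaves of [a n], and contractivity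
   of [1 - w] preserves the earlier estimates. *)
pose z : Elt := addA (scaleA (-1) (mulA w u)) (addA u w).
have wE l v : v - z l v =
    (v - u l v) - w l (v - u l v).
  rewrite (linear_opB _ _ (@inA_lin w l iw)) /z /addA /scaleA /mulA /= scaleN1r.
  by rewrite opprB !opprD opprK [X in v + X]addrCA !addrA.
exists z; first split.
- by apply: inA_lincomb; [exact: inA_mul|exact: inA_add].
- by move=> l v; rewrite wE (le_trans (cw _ _)).
move=> i l x; rewrite ltnS leq_eqVlt wE => /predU1P[->|i_n].
  by have := hw l x; rewrite /addA /scaleA /mulA /= scaleN1r [- _ + a n l x]addrC.
by rewrite (le_trans (cw _ _)) ?hu.
Qed.

End C0Sum.
Arguments maskA {R L H} P a l v.
Arguments rk {R L H} l p g m v : rename.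

(** * Linear and bilinear maps on the c0-sum *)

Section Functionals.
Context {R : realType}.
Local Notation C := R[i].
Variables (L : Type) (H : L -> completeNormedModType C).
Variable ip : forall l : L, H l -> H l -> C.
Arguments ip : clear implicits.
Hypothesis hip : forall l, is_inner_product (ip l).
Variable X : completeNormedModType C.
Local Notation Elt := (Elt H).
Implicit Types (a b c u w x y z d : Elt) (F : Elt -> X).

Lemma Elt_ext a b : (forall l v, a l v = b l v) -> a = b.
Proof.
by move=> h; apply/functional_extensionality_dep => l; apply/funext => v; exact: h.
Qed.

Lemma scaleA1 a : scaleA 1 a = a.
Proof. by apply: Elt_ext => l v; rewrite /scaleA scale1r. Qed.

Lemma linA_add F a b : linear_on_A F -> inA a -> inA b -> F (addA a b) = F a + F b.
Proof. by move=> lF ia ib; have := lF 1 a b ia ib; rewrite scaleA1 scale1r. Qed.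

Lemma linA_scale F k a : linear_on_A F -> inA a -> F (scaleA k a) = k *: F a.
Proof.
move=> lF ia; have iz := inA_scale 0 ia.
have F0 : F (scaleA 0 a) = 0.
  have := lF (-1) _ _ iz iz; rewrite scaleN1r addNr => <-; congr F.
  by apply: Elt_ext => l v; rewrite /addA /scaleA scale0r scaler0 addr0.
have := lF k _ _ ia iz; rewrite F0 addr0 => <-; congr F.
by apply: Elt_ext => l v; rewrite /addA /scaleA scale0r addr0.
Qed.

Lemma boundedA_nr F : bounded_on_A F -> exists2 M : R, 0 <= M &
  forall a s, inA a -> 0 <= s -> normA_le a s -> nr (F a) <= M * s.
Proof.
move=> [M hM]; exists `|M| => // a s ia s0 /hM-/(_ ia s0); rewrite nrE lecR.
by move=> /le_trans; apply; rewrite ler_wpM2r // ler_norm.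
Qed.

Lemma eq0_small (E : normedZmodType C) (t : E) K :
  (forall e : R, 0 < e -> nr t <= K * e) -> t = 0.
Proof.
move=> h; apply/eqP; rewrite -nr_eq0 eq_le nr_ge0 andbT.
apply/ler_addgt0Pl => d d0; rewrite addr0.
have K1 : 0 < `|K| + 1 by rewrite ltr_wpDl.
have /h/le_trans : 0 < d / (`|K| + 1) by rewrite divr_gt0.
apply; rewrite mulrA ler_pdivrMr // mulrC ler_wpM2l //; first exact: ltW.
by rewrite (le_trans (ler_norm K)) // lerDl.
Qed.

Section Density.
Variable F : Elt -> X.
Hypotheses (lF : linear_on_A F) (bF : bounded_on_A F).
Hypothesis F_rk : forall l (p : forall m, H m) (g : forall m, H m -> C),
  (forall m, bfun (g m)) -> F (rk l p g) = 0.

(** Consecutive residuals of [x] differ by a rank one element, on which [F] vanishes. So [F] has the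
    same value on all residuals, whose norms at [l] become arbitrarily small. *)
Lemma density_single l x : (forall m, compact_op (x m)) -> F (maskA (eq l) x) = 0.
Proof.
move=> cx; have [M M0 hM] := boundedA_nr bF.
pose y k : Elt := maskA (eq l) (fun m v => resid (ip m) (x m) k (x m v)).
have iy k : inA (y k).
  by apply: inA_mask_finite (finite_eq l) _ => m; exact: compact_residc.
have Fy k : F (y k) = F (maskA (eq l) x).
  elim: k => [//|k <-].
  pose g m v := ip m (resid (ip m) (x m) k (x m v)) (gvec (ip m) (x m) k).
  have bg m : bfun (g m).
    by apply: (bfun_ip (hip m) (residc_bdd (hip m) (cx m) k)); exact: gvec_unit0.
  have -> : y k = addA (rk l (fun m => gvec (ip m) (x m) k) g) (y k.+1).
    apply: Elt_ext => m v; rewrite /addA /rk /y.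
    have [lm|lm] := pselect (l = m); last by rewrite !maskAF // addr0.
    by rewrite !maskAT // residS addrC subrK.
  by rewrite linA_add ?F_rk ?add0r //; exact: inA_rk.
apply: (@eq0_small _ _ M) => e e0.
have [k hk] := gnorm_cvg0 (hip l) (cx l) e0.
rewrite -(Fy k) (hM _ _ (iy k) (ltW e0)) // => m.
apply: op_le_maskA => [|<-]; first exact: ltW.
apply: op_leW hk _; apply/op_leP => v; exact: resid_le_gnorm.
Qed.

(** Induction on a list containing the coordinates where [a l] exceeds [e]: each is split off and
    killed, and the rest has norm at most [e]. *)
Lemma density a : inA a -> F a = 0.
Proof.
move=> ia; have [M M0 hM] := boundedA_nr bF.
apply: (@eq0_small _ _ M) => e e0.
have [s] : exists s, forall l, ~ op_le (a l) e -> List.In l s.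
  by apply: (finite_listP (A := [set l | ~ op_le (a l) e])); case: ia => _; apply.
elim: s a ia => [|l s IH] a ia hs.
  by apply: hM => //; [exact: ltW|move=> l; apply: contrapT => /hs].
rewrite (maskA_split (eq l) a) linA_add //; [|exact: inA_mask..].
rewrite density_single ?add0r; last by case: ia.
apply: IH => [|m]; first exact: inA_mask.
have [<-|lm] := pselect (l = m).
  by rewrite maskAF; [case; apply: op_le0; exact: ltW|move=> /(_ erefl)].
by rewrite maskAT // => /hs[].
Qed.
End Density.

(** * From constancy on factorizations of [c] to the linear map on products *)

Section Bilinear.
Variables (V : Elt -> Elt -> X) (c : Elt).
Arguments c : clear implicits.
Hypotheses (hV : bounded_bilinear_on_A V) (ic : inA c).

Lemma V_linl b : inA b -> linear_on_A (V^~ b).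
Proof. by move=> ib k a1 a2 i1 i2; case: hV => h _ _; exact: h. Qed.

Lemma V_linr a : inA a -> linear_on_A (V a).
Proof. by move=> ia k b1 b2 i1 i2; case: hV => _ h _; exact: h. Qed.

Lemma V_bound : exists2 M : R, 0 <= M & forall a b s t, inA a -> inA b ->
  0 <= s -> 0 <= t -> normA_le a s -> normA_le b t -> nr (V a b) <= M * s * t.
Proof.
case: hV => _ _ [M hM]; exists `|M| => // a b s t ia ib s0 t0 ha hb.
have := hM a b s t ia ib s0 t0 ha hb; rewrite nrE lecR => /le_trans; apply.
by rewrite -!mulrA ler_wpM2r ?mulr_ge0 // ler_norm.
Qed.

Lemma rk_mul l m (p q : forall k, H k) (g h : forall k, H k -> C) :
  (forall k, bfun (g k)) ->
  mulA (rk l p g) (rk m q h) = scaleA (if `[< l = m >] then g l (q l) else 0) (rk l p h).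
Proof.
move=> bg; apply: Elt_ext => k v; rewrite /mulA /scaleA /rk /=.
have gZ j (a : C) : g j (a *: q j) = a * g j (q j).
  have [lg _] := bg j; have := lg a (q j) 0.
  have -> : g j 0 = 0 by have := lg (-1) 0 0; rewrite scaler0 addr0 mulN1r addNr.
  by rewrite !addr0.
have [lk|lk] := pselect (l = k); last by rewrite !maskAF // scaler0.
subst k; have [lm|lm] := pselect (l = m).
  by subst m; rewrite asboolT // !maskAT // gZ scalerA mulrC.
rewrite asboolF // (@maskAF _ _ _ (eq m)) ?maskAT //; last by move=> ml; apply: lm.
by rewrite -[X in g l X](scale0r (q l)) gZ mul0r !scale0r.
Qed.

Hypothesis room : forall l, has_room (c l).
Hypothesis hc : exists x0 : X, forall a b, inA a -> inA b -> mulA a b = c -> V a b = x0.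

Lemma V_rk_orth l m (p q : forall k, H k) (g h : forall k, H k -> C) :
  (forall k, bfun (g k)) -> (forall k, bfun (h k)) ->
  (l = m -> g l (q l) = 0) -> V (rk l p g) (rk m q h) = 0.
Proof.
move=> bg bh gq; have [x0 hx0] := hc.
(* Avoidance is requested at every coordinate: coordinate [l] yields [yb = 0] and coordinate [m]
   yields [az = 0]. *)
have [a [b [ia ib ab hab]]] := factorA_avoid hip q ic room bg.
set y := rk l p g; set z := rk m q h.
have iy : inA y by exact: inA_rk.
have iz : inA z by exact: inA_rk.
have yb k v : y k (b k v) = 0.
  rewrite /y /rk; have [lk|lk] := pselect (l = k); last by rewrite maskAF.
  by rewrite maskAT // (hab k).2 scale0r.
have az k v : a k (z k v) = 0.
  have la := @inA_lin _ _ _ a k ia.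
  rewrite /z /rk; have [mk|mk] := pselect (m = k).
    by rewrite maskAT // (linear_opZ _ _ la) (hab k).1 scaler0.
  by rewrite maskAF // (linear_op0 la).
have yz k v : y k (z k v) = 0.
  have := rk_mul l m p q h bg; rewrite -/y -/z => /(congr1 (fun e : Elt => e k v)).
  rewrite /mulA /scaleA /= => ->.
  have [lm|lm] := pselect (l = m); first by rewrite asboolT // gq // scale0r.
  by rewrite asboolF // scale0r.
have abE k v : a k (b k v) = c k v by rewrite -ab.
have la k := @inA_lin _ _ _ a k ia; have ly k := @inA_lin _ _ _ y k iy.
have h1 : V (addA a y) b = x0.
  apply: hx0 => //; first exact: inA_add.
  by apply: Elt_ext => k v; rewrite /mulA /addA /= yb addr0 abE.
have h2 : V a (addA b z) = x0.
  apply: hx0 => //; first exact: inA_add.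
  by apply: Elt_ext => k v; rewrite /mulA /addA /= (linear_opD _ _ (la k)) az addr0 abE.
have h3 : V (addA a y) (addA b z) = x0.
  apply: hx0; [exact: inA_add|exact: inA_add|].
  apply: Elt_ext => k v; rewrite /mulA /addA /=.
  by rewrite (linear_opD _ _ (la k)) (linear_opD _ _ (ly k)) az yb yz !addr0 abE.
have h4 := hx0 a b ia ib ab.
have ibz := inA_add ib iz.
(* [V (a + y) (b + z)] and [V a (b + z)] both equal [x0], so [V y b + V y z = 0]; [h1] and [h4] give
   [V y b = 0]. *)
move: h3; rewrite (linA_add (V_linl ibz)) // h2 (linA_add (V_linr iy)) //.
have : V y b = 0.
  by move: h1; rewrite (linA_add (V_linl ib)) // h4 => /(canRL (addKr _)); rewrite addNr.
by move=> ->; rewrite add0r => /(canRL (addKr _)); rewrite addNr.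
Qed.

Variable e : forall l, H l.
Hypothesis e1 : forall l, nr (e l) = 1.
Local Notation es := (fun l v => ip l v (e l)).

Lemma bfun_es l : bfun (es l).
Proof. by apply: (bfun_ip (hip l) (@bdd_id _ (H l))); right. Qed.

Lemma bfun_lincomb (E : completeNormedModType C) k (g h : E -> C) :
  bfun g -> bfun h -> bfun (fun v => k * g v + h v).
Proof.
move=> [lg [s s0 hs]] [lh [t t0 ht]]; split=> [a v w|].
  by rewrite lg lh; ring.
exists (nr k * s + t) => [|v]; first by rewrite addr_ge0 ?mulr_ge0 ?nr_ge0.
apply: le_trans (nrD _ _) _; rewrite nrM mulrDl lerD // -mulrA.
by rewrite ler_wpM2l ?nr_ge0.
Qed.

Lemma rk_lincomb_fun l (p : forall m, H m) (g h : forall m, H m -> C) k :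
  rk l p (fun m v => k * g m v + h m v) = addA (scaleA k (rk l p g)) (rk l p h).
Proof.
apply: Elt_ext => m v; rewrite /addA /scaleA /rk.
have [lm|lm] := pselect (l = m); last by rewrite !maskAF // scaler0 addr0.
by rewrite !maskAT // scalerDl scalerA.
Qed.

Lemma rk_lincomb_vec l (p q : forall m, H m) (g : forall m, H m -> C) k :
  rk l (fun m => k *: p m + q m) g = addA (scaleA k (rk l p g)) (rk l q g).
Proof.
apply: Elt_ext => m v; rewrite /addA /scaleA /rk.
have [lm|lm] := pselect (l = m); last by rewrite !maskAF // scaler0 addr0.
by rewrite !maskAT // scalerDr !scalerA mulrC.
Qed.

(* A form B(g, q) that vanishes whenever g(q) = 0 is a multiple of g(q):
   subtract the components along e and test on (k + e^*, m - k(m) e). *)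
Lemma V_rk l (p q : forall k, H k) (g h : forall k, H k -> C) :
  (forall k, bfun (g k)) -> (forall k, bfun (h k)) ->
  V (rk l p g) (rk l q h) = g l (q l) *: V (rk l p es) (rk l e h).
Proof.
move=> bg bh; pose B g q := V (rk l p g) (rk l q h).
have Bg k g1 g2 q1 : (forall j, bfun (g1 j)) -> (forall j, bfun (g2 j)) ->
    B (fun j v => k * g1 j v + g2 j v) q1 = k *: B g1 q1 + B g2 q1.
  move=> b1 b2; rewrite /B rk_lincomb_fun.
  by apply: V_linl; exact: inA_rk.
have Bq k g1 q1 q2 : (forall j, bfun (g1 j)) ->
    B g1 (fun j => k *: q1 j + q2 j) = k *: B g1 q1 + B g1 q2.
  by move=> b1; rewrite /B rk_lincomb_vec; apply: V_linr; exact: inA_rk.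
have B0 g1 q1 : (forall j, bfun (g1 j)) -> g1 l (q1 l) = 0 -> B g1 q1 = 0.
  by move=> b1 gq; exact: V_rk_orth.
have ee : ip l (e l) (e l) = 1 by rewrite (ipxx (hip l)) e1 expr1n.
pose al := g l (e l); pose be := ip l (q l) (e l).
pose k j v := - al * ip j v (e j) + g j v.
pose m j := - be *: e j + q j.
have bes := bfun_es.
have bk j : bfun (k j) by exact: bfun_lincomb.
have [lkl _] := bk l.
have ke : k l (e l) = 0 by rewrite /k ee mulr1 addNr.
have em : ip l (m l) (e l) = 0 by rewrite (ip_linl (hip l)) ee mulr1 addNr.
pose ga := k l (m l).
have kq : k l (q l) = ga.
  by rewrite /ga /m lkl ke mulr0 add0r.
have gq : g l (q l) = al * be + ga by rewrite -kq /k -/be; ring.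
have gE : g = fun j v => al * ip j v (e j) + k j v.
  apply/functional_extensionality_dep => j; apply/funext => v; rewrite /k; ring.
have qE : q = fun j => be *: e j + m j.
  apply/functional_extensionality_dep => j.
  by rewrite /m addrA -scalerDl subrr scale0r add0r.
have Bkm : B k m = ga *: B es e.
  have bek j : bfun (fun v => 1 * ip j v (e j) + k j v) by exact: bfun_lincomb.
  have cond : 1 * ip l (- ga *: e l + m l) (e l) + k l (- ga *: e l + m l) = 0.
    by rewrite (ip_linl (hip l)) lkl ee ke em -/ga; ring.
  have := B0 _ (fun j => - ga *: e j + m j) bek cond.
  rewrite (Bq _ _ _ _ bek) !(Bg 1 es k _ bes bk).
  rewrite (B0 es m bes em) (B0 k e bk ke) scaler0 add0r addr0 scale1r.
  by move=> /eqP; rewrite scaleNr addrC subr_eq0 => /eqP.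
rewrite -/(B g q) -/(B es e) gq.
rewrite [in LHS]gE (Bg al es k q bes bk) [X in B es X]qE [X in B k X]qE.
rewrite (Bq be es e m bes) (Bq be k e m bk).
by rewrite (B0 es m bes em) (B0 k e bk ke) Bkm addr0 scaler0 add0r scalerA scalerDl.
Qed.

(** On a common coordinate both sides are [g(p') g'(p'')] times the same value of [V], the one
    product scalar coming from [rk_mul] and the other from [V_rk]. If two adjacent coordinates
    differ, both sides vanish. *)
Lemma V_assoc_rk l m n (p p' p'' : forall k, H k) (g g' g'' : forall k, H k -> C) :
  (forall k, bfun (g k)) -> (forall k, bfun (g' k)) -> (forall k, bfun (g'' k)) ->
  V (mulA (rk l p g) (rk m p' g')) (rk n p'' g'') =
  V (rk l p g) (mulA (rk m p' g') (rk n p'' g'')).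
Proof.
move=> b b' b''; rewrite !rk_mul //.
rewrite (linA_scale _ (V_linl (inA_rk n p'' b''))) ?(linA_scale _ (V_linr (inA_rk l p b)));
  try exact: inA_rk.
have [lm|lm] := pselect (l = m); last first.
  by rewrite asboolF // scale0r V_rk_orth ?scaler0.
rewrite asboolT //; subst m.
have [ln|ln] := pselect (l = n); last first.
  by rewrite asboolF // scale0r V_rk_orth ?scaler0.
rewrite asboolT //; subst n.
by rewrite (V_rk l p p'' b' b'') (V_rk l p p' b b'') !scalerA mulrC.
Qed.

(** A bounded trilinear map, so that [density] can be applied to one argument at a time. *)
Definition assoc_defect y x w := V (mulA y x) w - V y (mulA x w).

Lemma assoc_defect_bound : exists2 M : R, 0 <= M & forall y x w r s t,
  inA y -> inA x -> inA w -> 0 <= r -> 0 <= s -> 0 <= t ->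
  normA_le y r -> normA_le x s -> normA_le w t ->
  nr (assoc_defect y x w) <= M * (r * s * t).
Proof.
have [M M0 hM] := V_bound; exists (M + M); first by rewrite addr_ge0.
move=> y x w r s t iy ix iw r0 s0 t0 hy hx hw; apply: le_trans (nrB _ _) _.
rewrite mulrDl lerD //.
  have := hM (mulA y x) w (r * s) t (inA_mul iy ix) iw (mulr_ge0 r0 s0) t0.
  by rewrite -mulrA; apply=> //; exact: normA_le_mul.
have := hM y (mulA x w) r (s * t) iy (inA_mul ix iw) r0 (mulr_ge0 s0 t0).
by rewrite !mulrA; apply=> //; exact: normA_le_mul.
Qed.

Lemma mulA_linl k y1 y2 x :
  mulA (addA (scaleA k y1) y2) x = addA (scaleA k (mulA y1 x)) (mulA y2 x).
Proof. exact: Elt_ext. Qed.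

Lemma mulA_linr k y x1 x2 : inA y ->
  mulA y (addA (scaleA k x1) x2) = addA (scaleA k (mulA y x1)) (mulA y x2).
Proof.
by move=> iy; apply: Elt_ext => l v; rewrite /mulA /= (@inA_lin _ _ _ y l iy).
Qed.

Lemma sub_lincomb (E : lmodType C) k (t1 t2 s1 s2 : E) :
  k *: t1 + t2 - (k *: s1 + s2) = k *: (t1 - s1) + (t2 - s2).
Proof. by rewrite opprD addrACA scalerBr. Qed.

Lemma assoc_defect_lin1 x w : inA x -> inA w -> linear_on_A (assoc_defect^~ x ^~ w).
Proof.
move=> ix iw k y1 y2 i1 i2; rewrite /assoc_defect mulA_linl.
by rewrite !(V_linl _ k) ?sub_lincomb //; exact: inA_mul.
Qed.

Lemma assoc_defect_lin2 y w : inA y -> inA w -> linear_on_A (assoc_defect y ^~ w).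
Proof.
move=> iy iw k x1 x2 i1 i2; rewrite /assoc_defect mulA_linl mulA_linr //.
rewrite (V_linl _ k) // ?(V_linr _ k) ?sub_lincomb //; exact: inA_mul.
Qed.

Lemma assoc_defect_lin3 y x : inA y -> inA x -> linear_on_A (assoc_defect y x).
Proof.
move=> iy ix k w1 w2 i1 i2; rewrite /assoc_defect mulA_linr //.
by rewrite !(V_linr _ k) ?sub_lincomb //; exact: inA_mul.
Qed.

Lemma bounded_of_nr F (M : R) :
  (forall a s, inA a -> 0 <= s -> normA_le a s -> nr (F a) <= M * s) -> bounded_on_A F.
Proof. by move=> h; exists M => a s ia s0 ha; rewrite nrE lecR; exact: h. Qed.

Lemma V_assoc y x w : inA y -> inA x -> inA w -> V (mulA y x) w = V y (mulA x w).
Proof.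
move=> iy ix iw; apply/eqP; rewrite -subr_eq0 -/(assoc_defect y x w).
have [M M0 hM] := assoc_defect_bound.
have [r r0 hr] := inA_bounded iy; have [s s0 hs] := inA_bounded ix.
have [t t0 ht] := inA_bounded iw.
apply/eqP; apply: (density (assoc_defect_lin1 ix iw)) iy => [|l p g bg].
  apply: (@bounded_of_nr _ (M * (s * t))) => a k ia k0 ha.
  by rewrite (_ : _ * k = M * (k * s * t)); [exact: hM|ring].
have ig := inA_rk l p bg; have [r' r'0 hr'] := inA_bounded ig.
apply: (density (assoc_defect_lin2 ig iw)) ix => [|m q h bh].
  apply: (@bounded_of_nr _ (M * (r' * t))) => a k ia k0 ha.
  by rewrite (_ : _ * k = M * (r' * k * t)); [exact: hM|ring].
have ih := inA_rk m q bh; have [s' s'0 hs'] := inA_bounded ih.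
apply: (density (assoc_defect_lin3 ig ih)) iw => [|n q' h' bh'].
  apply: (@bounded_of_nr _ (M * (r' * s'))) => a k ia k0 ha.
  by rewrite (_ : _ * k = M * (r' * s' * k)); [exact: hM|ring].
by rewrite /assoc_defect V_assoc_rk // subrr.
Qed.

(** By associativity [V u (mulA a b)] is [V (mulA u a) b], and [mulA u a] is close to [a]: up to a
    small error, [V a b] sees only the product. *)
Lemma V_approx : exists2 M : R, 0 <= M & forall a b u (d t : R),
  inA a -> inA b -> inA u -> 0 <= d -> 0 <= t -> normA_le b t ->
  (forall l v, nr (a l v - u l (a l v)) <= d * nr v) ->
  nr (V a b - V u (mulA a b)) <= M * d * t.
Proof.
have [M M0 hM] := V_bound; exists M => // a b u d t ia ib iu d0 t0 hb hd.
have iua := inA_mul iu ia.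
rewrite -V_assoc // -scaleN1r addrC -(V_linl ib) //.
apply: hM => //; first exact: inA_lincomb.
move=> l; apply/op_leP => x; rewrite /addA /scaleA /mulA /= scaleN1r addrC; exact: hd.
Qed.

(** One [u] approximates all three left factors, and [V u] is linear. This gives both the linearity
    of the map on products and its independence of the factorization. *)
Lemma V_prod_lin k (a1 a2 a3 b1 b2 b3 : Elt) :
  inA a1 -> inA a2 -> inA a3 -> inA b1 -> inA b2 -> inA b3 ->
  mulA a3 b3 = addA (scaleA k (mulA a1 b1)) (mulA a2 b2) ->
  V a3 b3 = k *: V a1 b1 + V a2 b2.
Proof.
move=> i1 i2 i3 j1 j2 j3 h; apply/eqP; rewrite -subr_eq0; apply/eqP.
have [M M0 hM] := V_approx.
have [t1 t10 ht1] := inA_bounded j1; have [t2 t20 ht2] := inA_bounded j2.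
have [t3 t30 ht3] := inA_bounded j3.
apply: (@eq0_small _ _ (M * t3 + nr k * (M * t1) + M * t2)) => d d0.
pose a n := if n is n'.+1 then if n' is n''.+1 then a3 else a2 else a1.
have ia n : inA (a n) by case: n => [|[|n]].
have [u [iu _] hu] := approx_unit hip 3 ia d0.
have e3 := hM a3 b3 u d t3 i3 j3 iu (ltW d0) t30 ht3 (fun l v => hu 2%N l v isT).
have e2 := hM a2 b2 u d t2 i2 j2 iu (ltW d0) t20 ht2 (fun l v => hu 1%N l v isT).
have e4 := hM a1 b1 u d t1 i1 j1 iu (ltW d0) t10 ht1 (fun l v => hu 0%N l v isT).
move: e3; rewrite h (V_linr iu) //; [|exact: inA_mul..] => e3.
set s1 := V u (mulA a1 b1) in e3 e4; set s2 := V u (mulA a2 b2) in e3 e2.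
have -> : V a3 b3 - (k *: V a1 b1 + V a2 b2) =
    (V a3 b3 - (k *: s1 + s2)) - (k *: (V a1 b1 - s1) + (V a2 b2 - s2)).
  by rewrite -sub_lincomb opprB addrA subrK.
apply: le_trans (nrB _ _) _.
apply: le_trans (lerD e3 (le_trans (nrD _ _) (lerD (lexx _) e2))) _.
rewrite nrZ; have := ler_wpM2l (nr_ge0 k) e4; lra.
Qed.

Lemma determined : exists phi : Elt -> X, [/\ linear_on_A phi, bounded_on_A phi &
  forall a b, inA a -> inA b -> V a b = phi (mulA a b)].
Proof.
have /choice[phi hphi] d : exists x : X, inA d ->
    exists a b, [/\ inA a, inA b, mulA a b = d & x = V a b].
  have [id|nd] := pselect (inA d); last by exists 0.
  by have [a [b [ia ib ab]]] := factorA hip id; exists (V a b) => _; exists a, b.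
have phiE a b : inA a -> inA b -> V a b = phi (mulA a b).
  move=> ia ib; have [a' [b' [ia' ib' ab' ->]]] := hphi _ (inA_mul ia ib).
  (* With [k = 0] the first pair is a dummy and the lemma says that equal products give equal
     values. *)
  rewrite (@V_prod_lin 0 a' a' a b' b' b) ?scale0r ?add0r // -ab'.
  by apply: Elt_ext => l v; rewrite /addA /scaleA scale0r add0r.
exists phi; split=> // [k d1 d2 i1 i2|].
  have [a1 [b1 [ia1 ib1 e1' ->]]] := hphi _ i1.
  have [a2 [b2 [ia2 ib2 e2' ->]]] := hphi _ i2.
  have [a3 [b3 [ia3 ib3 e3' ->]]] := hphi _ (inA_lincomb k i1 i2).
  by apply: V_prod_lin => //; rewrite e3' e1' e2'.
have [M M0 hM] := V_bound; have [M' M'0 hM'] := V_approx.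
apply: (@bounded_of_nr _ (M * 2)) => d s id s0 hd.
have [a [b [ia ib ab ->]]] := hphi _ id.
have [t t0 ht] := inA_bounded ib.
apply/ler_addgt0Pl => r r0.
(* The bound [t] depends on the factorization of [d], so the tolerance is chosen after it; its
   contribution is then at most [r]. *)
have K0 : 0 < M' * t + 1 by rewrite ltr_wpDl // mulr_ge0.
have d0 : 0 < r / (M' * t + 1) by rewrite divr_gt0.
have [u [iu cu] hu] := approx_unit1 hip ia d0.
(* [1 - u] is a contraction, so [u] has norm at most 2, whatever [d] is; hence the final constant
   [M * 2]. *)
have hu2 : normA_le u 2.
  move=> l; apply/op_leP => v; have := nrB v (v - u l v).
  by rewrite opprB addrC subrK; have := cu l v; lra.
have := hM' a b u _ t ia ib iu (ltW d0) t0 ht hu; rewrite ab => h1.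
have := hM u d 2 s iu id (ler0n _ _) s0 hu2 hd => h2.
have h3 := nrD (V a b - V u d) (V u d); rewrite subrK in h3.
have : M' * (r / (M' * t + 1)) * t <= r.
  rewrite (_ : _ * t = r * (M' * t) / (M' * t + 1)); last by field; rewrite gt_eqF.
  by rewrite ler_pdivrMr // ler_wpM2l ?lerDl // ltW.
lra.
Qed.

End Bilinear.
End Functionals.

Theorem mainTheorem1 (R : realType) (L : Type)
  (H : L -> completeNormedModType R[i])
  (ip : forall l : L, H l -> H l -> R[i])
  (hip : forall l : L, is_inner_product (ip l)) :
  (forall c : Elt H, inA c -> pi_rank_hyp c -> determined_at c) /\
  ((forall l : L, ~ finite_dim (H l)) ->
     forall c : Elt H, inA c -> determined_at c).
Proof.
have main (c : Elt H) : inA c -> pi_rank_hyp c -> determined_at c.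
  move=> ic room X V hV [phi [_ hphi]].
  (* The rank hypothesis also makes every [H l] nonzero, which supplies the reference unit
     vectors. *)
  have h l : exists v : H l, nr v = 1 by exact: room_unit (room l).
  apply: (determined hip hV ic room _ (fun l => projT2 (cid (h l)))).
  by exists (phi c) => a b ia ib ab; rewrite hphi // ab.
by split=> // inf c ic; apply: main => // l; left.
Qed.
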